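(* Let $\mathfrak g_A=\mathbb Re_0\ltimes_A\mathbb R^5$. For each row below, let $A$ satisfy the conditions of the corresponding case (and the corresponding pattern restriction, both given in the context), and set $\rho=\exp(\mathbf i\omega)\wedge\Omega$. Then $\rho$ defines a left-invariant generalized complex structure of the indicated type $k$ on $G_A$. More precisely, $$\mathrm d\rho=-\Lambda e^0\wedge\rho,\qquad \omega^{3-k}\wedge\Omega\wedge\overline\Omega=c_\rho\,e^{012345},$$ with the listed $\Lambda$ and nonzero constant $c_\rho$. The displayed invariant generator $\rho$ is closed if and only if $\Lambda=0$. Rows (case, type $k$; products of forms are wedge products; $\eta=e^1+\mathbf ie^2$, $\tau=a+\mathbf ib$): - 4, $k=1$: $\Omega=e^4+\mathbf ie^5$, $\omega=e^{01}+e^{23}$, $\Lambda=\mu$, $c_\rho=-4\mathbf i$. - 4, $k=2$: $\Omega=(\mathbf ie^0+e^3)(e^4+\mathbf ie^5)$, $\omega=e^{12}$, $\Lambda=\mu$, $c_\rho=-4$. - 5, $k=1$: $\Omega=e^2+\mathbf ie^5$, $\omega=e^{01}+e^{34}$, $\Lambda=\lambda$, $c_\rho=-4\mathbf i$. - 5, $k=2$: $\Omega=(e^0+e^1+\mathbf ie^5)(\mathbf ie^0+e^2)$, $\omega=e^{34}$, $\Lambda=2\lambda$, $c_\rho=4$. - 6a, $k=1$: $\Omega=e^2+\mathbf ie^3$, $\omega=e^{01}+e^{45}$, $\Lambda=\lambda$, $c_\rho=-4\mathbf i$. - 6a, $k=2$: $\Omega=(e^0+e^1+\mathbf ie^3)(\mathbf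 ie^0+e^2)$, $\omega=e^{45}$, $\Lambda=2\lambda$, $c_\rho=4$. - 6b, $k=1$: $\Omega=e^3+\mathbf ie^4$, $\omega=e^{01}+e^{25}$, $\Lambda=\alpha$, $c_\rho=-4\mathbf i$. - 6b, $k=2$: $\Omega=(\mathbf ie^0+e^2)(e^3+\mathbf ie^4)$, $\omega=e^{15}$, $\Lambda=\lambda+\alpha$, $c_\rho=4$. - 6c, $k=1$: $\Omega=e^3+\mathbf ie^4$, $\omega=e^{05}+e^{12}$, $\Lambda=\mu$, $c_\rho=-4\mathbf i$. - 7, $k=1$: $\Omega=e^0+\eta$, $\omega=e^{12}+e^{03}+e^{45}$, $\Lambda=\tau$, $c_\rho=-4\mathbf i$. - 7, $k=2$: $\Omega=\eta(e^0-\mathbf ie^5)$, $\omega=e^{34}$, $\Lambda=\tau$, $c_\rho=-4$. - 8a, $k=1$: $\Omega=e^0+\eta$, $\omega=e^{12}+e^{03}+e^{45}$, $\Lambda=\tau$, $c_\rho=-4\mathbf i$. - 8a, $k=2$: $\Omega=\eta(e^0-\mathbf ie^4)$, $\omega=e^{35}$, $\Lambda=\tau+\lambda$, $c_\rho=4$. - 8b, $k=1$: $\Omega=e^0+\eta$, $\omega=e^{12}+e^{34}+e^{05}$, $\Lambda=\tau$, $c_\rho=-4\mathbf i$. - 8b, $k=2$: $\Omega=\eta(e^0-\mathbf ie^5)$, $\omega=e^{34}$, $\Lambda=\tau+\mu$, $c_\rho=-4$. - 9, $k=1$: $\Omega=e^0+\eta$, $\omega=e^{34}+e^{05}$, $\Lambda=\tau$,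 $c_\rho=-4\mathbf i$. - 9, $k=2$: $\Omega=\eta(e^0-\mathbf ie^5)$, $\omega=e^{34}$, $\Lambda=\tau+\nu$, $c_\rho=-4$. - 10, $k=1$: $\Omega=e^1+\mathbf ie^2$, $\omega=e^{03}+e^{45}$, $\Lambda=\lambda$, $c_\rho=-4\mathbf i$. - 10, $k=2$: $\Omega=(e^1+\mathbf ie^2)(e^0+\mathbf ie^3)$, $\omega=e^{45}$, $\Lambda=\lambda+\mu$, $c_\rho=4$.
   Context: Notation. $\mathfrak g_A=\mathbb Re_0\ltimes_A\mathfrak h$, $\mathfrak h=\mathbb R^5$ an abelian ideal with basis $e_1,\dots,e_5$, $[e_0,v]=Av$; $G_A$ is the simply connected Lie group with Lie algebra $\mathfrak g_A$; $e^0,\dots,e^5$ is the dual basis and $e^{i_1\cdots i_r}=e^{i_1}\wedge\cdots\wedge e^{i_r}$. All parameters are real. The differential on $\bigwedge^\bullet\mathfrak g_A^*$ is the derivation with $\mathrm d\xi(X,Y)=-\xi([X,Y])$; thus $\mathrm de^0=0$ and $\mathrm de^p=-e^0\wedge A^Te^p$ with $A^Te^p=\sum_i a_{pi}e^i$. $J_r(t)$ is the $r\times r$ Jordan block with eigenvalue $t$ and ones on the superdiagonal (so $A^Te^j=te^j+e^{j+1}$ along a block, without the second term at the last covector), $C(a,b)=\begin{pmatrix}a&-b\\ b&a\end{pmatrix}$ with $b\ne0$ (so $A^T\eta=\tau\eta$), and a scalar summand is a $1\times1$ block. The coframe is ordered by the displayed matrix. Cases and conditions: - Case 4: $A=J_3(\lambda)\oplus\mu\oplus\nu$,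 $\lambda=0$, $\mu=\nu$. - Case 5: $A=J_2(\lambda)\oplus J_2(\mu)\oplus\nu$, $\mu=0$, $\nu=\lambda$. - Case 6a: $A=J_2(\lambda)\oplus\mu\oplus\nu\oplus\gamma$, $\mu=\lambda$, $\gamma=-\nu$. - Case 6b: $A=J_2(\lambda)\oplus\mu\oplus\nu\oplus\gamma$, $\mu=\nu=\alpha$, $\gamma=-\lambda$. - Case 6c: $A=J_2(\lambda)\oplus\mu\oplus\nu\oplus\gamma$, $\lambda=0$, $\mu=\nu$. - Case 7: $A=C(a,b)\oplus J_3(\lambda)$, $b\ne0$, $\lambda=0$. - Case 8a: $A=C(a,b)\oplus J_2(\lambda)\oplus\mu$, $b\ne0$, $\lambda+\mu=0$. - Case 8b: $A=C(a,b)\oplus J_2(\lambda)\oplus\mu$, $b\ne0$, $\lambda=0$. - Case 9: $A=C(a,b)\oplus\lambda\oplus\mu\oplus\nu$, $b\ne0$, $\lambda+\mu=0$. - Case 10: $A=\mathrm{diag}(\lambda,\lambda,\mu,\zeta,-\zeta)$. Standing assumption: $\mathfrak g_A$ admits neither a complex nor a symplectic structure; this is expressed by the following pattern restrictions, also in force. Eigenvalue lists are multisets; two identical pairs means four entries grouped as $\{r,r\},\{s,s\}$ and two opposite pairs means four entries grouped as $\{r,-r\},\{s,-s\}$, using disjoint occurrences (two zeros form an opposite pair). - (4) $J_3(\lambda)\oplus\mu\oplus\nu$: $\lambda\ne0$ or $\mu\ne-\nu$. - (5) $J_2(\lambda)\oplus J_2(\mu)\oplus\nu$: $\lambda\ne\pm\mu$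 and $\{\lambda,\mu,\nu\}\ne\{0,-\alpha,\alpha\}$ for every $\alpha\in\mathbb R$. - (6) $J_2(\lambda)\oplus\mu\oplus\nu\oplus\gamma$: $\{\lambda,\mu,\nu,\gamma\}$ contains neither two identical pairs nor two opposite pairs; if $\lambda=0$, $\{\mu,\nu,\gamma\}$ also contains no opposite pair. - (7) $C(a,b)\oplus J_3(\lambda)$: $(a,\lambda)\ne(0,0)$. - (8) $C(a,b)\oplus J_2(\lambda)\oplus\mu$: $\lambda\ne\mu$; if $a=0$, also $\lambda\ne-\mu$ and $\lambda\ne0$. - (9) $C(a,b)\oplus\lambda\oplus\mu\oplus\nu$: $\{\lambda,\mu,\nu\}$ contains no identical pair; if $a=0$, also no opposite pair. - (10) diagonal $A$: the spectrum contains neither two identical pairs nor two opposite pairs. Left-invariant generalized complex structures: for a Lie group $G$ with Lie algebra $\mathfrak g$ of real dimension $2n$ (here $n=3$), give $\mathfrak g\oplus\mathfrak g^*$ the pairing $\langle X+\xi,Y+\eta\rangle=\frac12(\xi(Y)+\eta(X))$. A left-invariant generalized complex structure is (equivalently) a linear map $\mathcal J$ of $\mathfrak g\oplus\mathfrak g^*$ with $\mathcal J^2=-\mathrm{Id}$, orthogonal for the pairing, whose $\mathbf i$-eigenspace $L\subset(\mathfrak g\oplus\mathfrak g^* )\otimes\mathbb C$ is closed under $[[X+\xi,Y+\eta]]=[X,Y]+\mathrm{ad}^*_X\eta-\mathrm{ad}^*_Y\xi$, with $(\mathrm{ad}^*_X\eta)(Y)=-\eta([X,Y])$. The space $L$ is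 the annihilator, for the Clifford action $(X+\xi)\cdot\rho=\iota_X\rho+\xi\wedge\rho$, of a unique complex line $K_L\subset\bigwedge^\bullet\mathfrak g^*\otimes\mathbb C$. Any generator $\rho$ of $K_L$ (an invariant generator; one says $\rho$ defines $\mathcal J$) has the form $\exp(B+\mathbf i\omega)\wedge\Omega$ with $B,\omega$ real $2$-forms and $\Omega=\theta_1\wedge\cdots\wedge\theta_k$ with linearly independent $\theta_i\in\mathfrak g^*\otimes\mathbb C$ ($\Omega$ a nonzero constant if $k=0$), and satisfies $\omega^{n-k}\wedge\Omega\wedge\overline\Omega\ne0$; $k$ is the type. *)

(* Defs.v *)
From HB Require Import structures.
From mathcomp Require Import all_boot all_order all_algebra ring.
From mathcomp Require Import complex.
From mathcomp Require Export reals.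

Set Implicit Arguments.
Unset Strict Implicit.
Unset Printing Implicit Defensive.
Import Order.TTheory GRing.Theory Num.Theory.
Local Open Scope ring_scope.

(* The exterior algebra of the dual of F^m.  The value [a S] is the coefficient
   of e^S = e^{i_1} ^ ... ^ e^{i_r}, where S = {i_1 < ... < i_r}.  The wedge
   product is the ring multiplication, so an r-fold product of one-forms has
   its usual meaning and [a ^+ k] is the k-fold wedge power. *)
Definition ext (F : Type) (m : nat) := {ffun {set 'I_m} -> F}.

(* The exponent of the sign in e^T ^ e^U = +- e^(T u U) for disjoint T, U. *)
Definition inv_count m (T U : {set 'I_m}) : nat :=
  (\sum_(i in T) \sum_(j in U) (j < i))%N.

Section InvCount.
Variable m : nat.
Implicit Types (i : 'I_m) (S T U V : {set 'I_m}).

Lemma inv_count0l U : inv_count set0 U = 0%N.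
Proof. by rewrite /inv_count big_set0. Qed.

Lemma inv_count0r T : inv_count T set0 = 0%N.
Proof. by rewrite /inv_count big1 // => i _; rewrite big_set0. Qed.

Lemma inv_countUl T U V : [disjoint T & U] ->
  inv_count (T :|: U) V = (inv_count T V + inv_count U V)%N.
Proof.
by move=> dTU; rewrite /inv_count (eq_bigl [predU T & U]) ?bigU// => i;
  rewrite !inE.
Qed.

Lemma inv_countUr T U V : [disjoint U & V] ->
  inv_count T (U :|: V) = (inv_count T U + inv_count T V)%N.
Proof.
move=> dUV; rewrite /inv_count -big_split; apply: eq_bigr => i _.
by rewrite (eq_bigl [predU U & V]) ?bigU// => j; rewrite !inE.
Qed.

Lemma inv_count_swap T U : [disjoint T & U] ->
  (inv_count T U + inv_count U T)%N = (#|T| * #|U|)%N.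
Proof.
move=> dTU; rewrite /inv_count [X in (_ + X)%N]exchange_big /= -big_split /=.
rewrite -sum_nat_const; apply: eq_bigr => i iT; rewrite -big_split /= -sum1_card.
apply: eq_bigr => j jU; case: (ltngtP i j) => // eqij.
by move: (disjointFr dTU iT); rewrite (val_inj eqij) jU.
Qed.

End InvCount.

Section ExteriorAlgebra.
Variables (F : comNzRingType) (m : nat).
Implicit Types (S T U : {set 'I_m}).

HB.instance Definition _ := GRing.Zmodule.copy (ext F m) {ffun {set 'I_m} -> F}.

Definition ext_scale (x : F) (a : ext F m) : ext F m := [ffun S : {set 'I_m} => x * a S].

Fact ext_scaleA x y (a : ext F m) :
  ext_scale x (ext_scale y a) = ext_scale (x * y) a.
Proof. by apply/ffunP => S; rewrite !ffunE mulrA. Qed.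

Fact ext_scale1 : left_id 1 ext_scale.
Proof. by move=> a; apply/ffunP => S; rewrite !ffunE mul1r. Qed.

Fact ext_scaleDr : right_distributive ext_scale +%R.
Proof. by move=> x a b; apply/ffunP => S; rewrite !ffunE mulrDr. Qed.

Fact ext_scaleDl (a : ext F m) : {morph ext_scale^~ a : x y / x + y}.
Proof. by move=> x y; apply/ffunP => S; rewrite !ffunE mulrDl. Qed.

HB.instance Definition _ := GRing.Zmodule_isLmodule.Build F (ext F m)
  ext_scaleA ext_scale1 ext_scaleDr ext_scaleDl.

Implicit Types a b c : ext F m.

Definition wedge a b : ext F m :=
  [ffun S : {set 'I_m} => \sum_(T : {set 'I_m} | T \subset S)
    (-1) ^+ inv_count T (S :\: T) * (a T * b (S :\: T))].

Definition ext_one : ext F m := [ffun S : {set 'I_m} => (S == set0)%:R].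

Lemma wedgeA : associative wedge.
Proof.
move=> a b c; apply/ffunP => S; rewrite !ffunE.
under eq_bigr => T TS do rewrite ffunE mulr_sumr mulr_sumr.
under [in RHS]eq_bigr => W WS do rewrite ffunE mulr_suml mulr_sumr.
rewrite [RHS](exchange_big_dep (fun T : {set 'I_m} => T \subset S)) /=; last first.
  by move=> W T WS TW; apply: subset_trans WS.
apply: eq_bigr => T TS.
rewrite [RHS](reindex_onto (fun U => T :|: U) (fun W => W :\: T)) /=; last first.
  by move=> W /andP[_ TW]; rewrite setUC -{2}(setID W T) (setIidPr TW) setUC.
have eqP0 U : [&& T :|: U \subset S, T \subset T :|: U & (T :|: U) :\: T == U]
              = (U \subset S :\: T).
  rewrite subUset TS subsetUl /= setDUl setDv set0U subsetD.
  by congr (_ && _); apply/eqP/setDidPl.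
apply: eq_big => [U|U UST]; first by rewrite -eqP0 andbA.
have [US dUT] : U \subset S /\ [disjoint U & T].
  by move: UST; rewrite subsetD => /andP.
have -> : (T :|: U) :\: T = U by rewrite setDUl setDv set0U; apply/setDidPl.
rewrite -setDDl; set V := S :\: T :\: U.
have eV : S :\: T = U :|: V.
  by rewrite /V -{1}(setID (S :\: T) U) (setIidPr UST).
have dUV : [disjoint U & V].
  by rewrite -setI_eq0; apply/eqP/setP => i; rewrite !inE; case: (i \in U).
rewrite eV inv_countUr// inv_countUl 1?disjoint_sym// !exprD; ring.
Qed.

Lemma wedge1l : left_id ext_one wedge.
Proof.
move=> a; apply/ffunP => S; rewrite ffunE (bigD1 set0) ?sub0set//= big1.
  by rewrite ffunE eqxx setD0 inv_count0l expr0 !mul1r addr0.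
by move=> T /andP[_ /negPf T0]; rewrite ffunE T0 mul0r mulr0.
Qed.

Lemma wedge1r : right_id ext_one wedge.
Proof.
move=> a; apply/ffunP => S; rewrite ffunE (bigD1 S)//= big1.
  by rewrite ffunE setDv eqxx inv_count0r expr0 mul1r mulr1 addr0.
move=> T /andP[TS TneS]; rewrite ffunE setD_eq0.
have /negPf -> : ~~ (S \subset T) by apply: contra TneS => ST; rewrite eqEsubset TS.
by rewrite !mulr0.
Qed.

Lemma wedgeDl : left_distributive wedge +%R.
Proof.
move=> a b c; apply/ffunP => S; rewrite !ffunE -big_split; apply: eq_bigr => T _.
by rewrite /= ffunE mulrDl mulrDr.
Qed.

Lemma wedgeDr : right_distributive wedge +%R.
Proof.
move=> a b c; apply/ffunP => S; rewrite !ffunE -big_split; apply: eq_bigr => T _.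
by rewrite /= ffunE !mulrDr.
Qed.

Lemma ext_one_neq0 : ext_one != 0.
Proof.
by apply/eqP => /ffunP/(_ set0)/eqP; rewrite !ffunE eqxx oner_eq0.
Qed.

HB.instance Definition _ := GRing.Zmodule_isNzRing.Build (ext F m)
  wedgeA wedge1l wedge1r wedgeDl wedgeDr ext_one_neq0.

Fact ext_scaleAl x a b : x *: (a * b) = (x *: a) * b.
Proof.
apply/ffunP => S; rewrite !ffunE mulr_sumr; apply: eq_bigr => T _.
by rewrite ffunE; ring.
Qed.

HB.instance Definition _ := GRing.Lmodule_isLalgebra.Build F (ext F m) ext_scaleAl.

Fact ext_scaleAr x a b : x *: (a * b) = a * (x *: b).
Proof.
apply/ffunP => S; rewrite !ffunE mulr_sumr; apply: eq_bigr => T _.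
by rewrite ffunE; ring.
Qed.

HB.instance Definition _ := GRing.Lalgebra_isAlgebra.Build F (ext F m) ext_scaleAr.

End ExteriorAlgebra.

(* Finite-dimensional Lie algebras, in coordinates: the underlying space is the
   space of column vectors. *)
Record lieAlgebra (F : comNzRingType) (m : nat) := LieAlgebra {
  lie_br :> 'cV[F]_m -> 'cV[F]_m -> 'cV[F]_m;
  lie_linear_l : forall y, linear (lie_br^~ y);
  lie_linear_r : forall x, linear (lie_br x);
  lie_alt : forall x, lie_br x x = 0;
  lie_jacobi : forall x y z,
    lie_br x (lie_br y z) + lie_br y (lie_br z x) + lie_br z (lie_br x y) = 0
}.

Section ExteriorCalculus.
Variables (F : comNzRingType) (m : nat).
Implicit Types (g : lieAlgebra F m) (a b c : ext F m) (X Y : 'cV[F]_m) (xi : 'rV[F]_m).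

(* Covectors are row vectors and vectors are column vectors: xi(X) = xi *m X. *)
Definition covec xi : ext F m :=
  [ffun S : {set 'I_m} => \sum_(i | S == [set i]) xi 0 i].

Definition homog (p : nat) a := forall S : {set 'I_m}, a S != 0 -> #|S| = p.

(* The interior product iota_X. *)
Definition contr X a : ext F m :=
  [ffun S : {set 'I_m} =>
    \sum_(i | i \notin S) (-1) ^+ inv_count [set i] S * (X i 0 * a (i |: S))].

(* The exponential of an even form without constant term: [a ^+ k] vanishes
   for 2 k > m, so that the sum below is the full series. *)
Definition ext_exp (K : fieldType) (n : nat) (a : ext K n) : ext K n :=
  \sum_(k < n.+1) (k`!)%:R^-1 *: a ^+ k.

(* The differential of a one-form, (d xi)(X, Y) = - xi([X, Y]). *)
Definition ce_d1 g xi : ext F m :=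
  - \sum_(i < m) \sum_(j < m | (i < j)%N)
      (xi *m g (delta_mx i 0) (delta_mx j 0)) 0 0 *:
      (covec (delta_mx 0 i) * covec (delta_mx 0 j)).

(* The derivation extending [ce_d1]: the sum over p of d(e^p) ^ iota_{e_p}.
   It is characterised by [ce_d_is_linear], [ce_d_covec], [ce_d_one],
   [ce_d_leibniz], and [ce_d_eval]. *)
Definition ce_d g a : ext F m :=
  \sum_p ce_d1 g (delta_mx 0 p) * contr (delta_mx p 0) a.

Lemma homog_covec xi : homog 1 (covec xi).
Proof.
move=> S; rewrite ffunE; have [/pred0P S0|/pred0Pn[i /eqP ->]] :=
  boolP (pred0b (fun i => S == [set i])); last by rewrite cards1.
by rewrite big_pred0 ?eqxx.
Qed.

Lemma homogM p q a b : homog p a -> homog q b -> homog (p + q) (a * b).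
Proof.
move=> ha hb S; rewrite ffunE; apply: contra_neq_eq => neS.
rewrite big1// => T TS; case: (eqVneq (a T) 0) => [->|/ha aT].
  by rewrite mul0r mulr0.
case: (eqVneq (b (S :\: T)) 0) => [->|/hb bT]; first by rewrite !mulr0.
by move: neS; rewrite -(cardsID T S) (setIidPr TS) aT bT eqxx.
Qed.

Lemma homogZ p x a : homog p a -> homog p (x *: a).
Proof.
move=> ha S; rewrite ffunE => /negPf xa; apply: ha.
by apply/negP => /eqP aS; rewrite aS mulr0 eqxx in xa.
Qed.

Lemma homogD p a b : homog p a -> homog p b -> homog p (a + b).
Proof.
move=> ha hb S; rewrite ffunE; case: (eqVneq (a S) 0) => [->|/ha//].
by rewrite add0r => /hb.
Qed.

Lemma homog0 p : homog p 0.
Proof. by move=> S; rewrite ffunE eqxx. Qed.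

Lemma homogN p a : homog p a -> homog p (- a).
Proof. by move=> ha; rewrite -scaleN1r; apply: homogZ. Qed.

Lemma homog_sum p (I : Type) (r : seq I) (P : pred I) (f : I -> ext F m) :
  (forall i, P i -> homog p (f i)) -> homog p (\sum_(i <- r | P i) f i).
Proof. by move=> h; elim/big_rec: _ => [|i x /h]; [exact: homog0|exact: homogD]. Qed.

Lemma homog_ce_d1 g xi : homog 2 (ce_d1 g xi).
Proof.
apply: homogN; do 2 apply: homog_sum => ? _.
by apply: homogZ; apply: (@homogM 1 1); apply: homog_covec.
Qed.

Lemma wedgeC p q a b : homog p a -> homog q b -> a * b = (-1) ^+ (p * q) *: (b * a).
Proof.
move=> ha hb; apply/ffunP => S; rewrite !ffunE mulr_sumr.
rewrite (reindex_onto (fun U => S :\: U) (fun U => S :\: U)) /=; last first.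
  by move=> T TS; rewrite setDDr setDv set0U (setIidPr TS).
apply: eq_big => [U|U /andP[_ /eqP eU]].
  by rewrite subsetDl setDDr setDv set0U /=; apply/eqP/idP => /setIidPr.
have US : U \subset S by rewrite -eU subsetDl.
rewrite eU; case: (eqVneq (a (S :\: U)) 0) => [->|/ha aT].
  by rewrite !(mul0r, mulr0).
case: (eqVneq (b U) 0) => [->|/hb bT]; first by rewrite !(mul0r, mulr0).
have dU : [disjoint S :\: U & U] by rewrite disjoint_sym disjoints_subset subsetC subsetDr.
rewrite -aT -bT -(inv_count_swap dU) exprD.
have := sqrr_sign F (inv_count U (S :\: U)); rewrite expr2 => e1.
rewrite [a _ * _]mulrC -[LHS]mulr1 -[X in _ * X = _]e1; ring.
Qed.

Lemma contr_is_linear X : linear (contr X).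
Proof.
move=> x a b; apply/ffunP => S; rewrite !ffunE mulr_sumr -big_split.
by apply: eq_bigr => i _; rewrite /= !ffunE; ring.
Qed.

HB.instance Definition _ X :=
  GRing.isLinear.Build F (ext F m) (ext F m) *:%R (contr X) (contr_is_linear X).

Lemma contr_linearl a : linear (contr^~ a).
Proof.
move=> x X Y; apply/ffunP => S; rewrite !ffunE mulr_sumr -big_split.
by apply: eq_bigr => i _; rewrite /= !mxE; ring.
Qed.

(* The interior product with the i-th basis vector. *)
Let contri (i : 'I_m) a : ext F m :=
  [ffun S : {set 'I_m} =>
    if i \in S then 0 else (-1) ^+ inv_count [set i] S * a (i |: S)].

Let contrE X a : contr X a = \sum_i X i 0 *: contri i a.
Proof.
apply/ffunP => S; rewrite sum_ffunE ffunE big_mkcond; apply: eq_bigr => i _.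
by rewrite !ffunE; case: (i \in S); rewrite /= ?mulr0//; ring.
Qed.

Let contriM p i a b : homog p a ->
  contri i (a * b) = contri i a * b + (-1) ^+ p *: (a * contri i b).
Proof.
move=> ha; apply/ffunP => S; rewrite !ffunE [X in _ + X]mulr_sumr.
have dset1 (T : {set 'I_m}) : i \notin T -> [disjoint [set i] & T].
  by rewrite disjoints1.
have reix (f : {set 'I_m} -> F) (S' : {set 'I_m}) : i \in S' ->
    \sum_(T : {set 'I_m} | (T \subset S') && (i \in T)) f T =
    \sum_(T : {set 'I_m} | (T \subset S') && (i \notin T)) f (i |: T).
  move=> iS; rewrite (reindex_onto (fun T => i |: T) (fun T => T :\ i)) /=.
    apply: eq_bigl => T; rewrite subUset sub1set iS setU11 andbT /=.
    congr (_ && _); apply/eqP/idP => [<-|iT]; first by rewrite setD11.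
    by rewrite setU1K.
  by move=> T /andP[_ iT]; rewrite setD1K.
case: (boolP (i \in S)) => iS.
  rewrite (bigID (fun T : {set 'I_m} => i \in T)) /= big1 ?add0r; last first.
    by move=> T /andP[_ iT]; rewrite ffunE iT mul0r mulr0.
  rewrite [X in _ + X](bigID (fun T : {set 'I_m} => i \in T)) /=.
  rewrite [X in _ + (_ + X)]big1 ?addr0; last first.
    by move=> T /andP[_ iT]; rewrite ffunE inE iT iS /= !mulr0.
  rewrite reix// -big_split big1//= => T /andP[TS iT].
  rewrite !ffunE (negPf iT) !inE eqxx /=.
  set U := S :\: (i |: T).
  have iU : i \notin U by rewrite !inE eqxx.
  have eU : S :\: T = i |: U.
    by apply/setP => j; rewrite !inE; case: eqP => // ->; rewrite iT iS.
  rewrite eU.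
  case: (eqVneq (a (i |: T)) 0) => [->|/ha]; first by rewrite !(mul0r, mulr0) addr0.
  rewrite cardsU1 iT => <-.
  rewrite -[X in (_ + X)%N]mul1n -(cards1 i) -(inv_count_swap (dset1 _ iT)) /=.
  rewrite inv_countUr ?inv_countUl ?dset1 1?disjoint_sym ?dset1//.
  have := sqrr_sign F (inv_count [set i] U); rewrite expr2 => e1.
  have := sqrr_sign F (inv_count [set i] T); rewrite expr2 => e2.
  rewrite !exprD expr1; move: e1 e2; set x := (-1) ^+ _; set y := (-1) ^+ _ => e1 e2.
  set z := (-1) ^+ _; set t := (-1) ^+ _.
  have -> : forall u v, z * t * (y * u * v) + - 1 * (y * z) * (x * t * (u * (x * v))) =
     (1 - x * x) * (z * t * y * u * v) by move=> u v; ring.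
  by rewrite e1 subrr mul0r.
rewrite (bigID (fun T : {set 'I_m} => i \in T)) /= reix ?setU11// mulrDr.
have subE (T : {set 'I_m}) : (T \subset i |: S) && (i \notin T) = (T \subset S).
  apply/andP/idP => [[TiS iT]|TS]; last first.
    by split; [by rewrite (subset_trans TS)// subsetUr|apply: contra iS; exact: (subsetP TS)].
  by apply/subsetP => j jT; have := subsetP TiS j jT; rewrite !inE => /predU1P[ji|//];
     rewrite -ji jT in iT.
rewrite !mulr_sumr; congr (_ + _); apply: eq_big => // T; rewrite subE => TS.
  have iT : i \notin T by apply: contra iS; exact: (subsetP TS).
  have -> : (i |: S) :\: (i |: T) = S :\: T.
    by apply/setP => j; rewrite !inE; case: eqP => //= ->; rewrite (negPf iS) andbF.
  rewrite ffunE (negPf iT).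
  have eS : S = T :|: S :\: T by rewrite -{1}(setID S T) (setIidPr TS).
  have iU : i \notin S :\: T by rewrite inE (negPf iS) andbF.
  have dTU : [disjoint T & S :\: T].
    by rewrite -setI_eq0; apply/eqP/setP => j; rewrite !inE; case: (j \in T).
  rewrite {1}eS inv_countUr// inv_countUl ?dset1// !exprD.
  have := sqrr_sign F (inv_count [set i] (S :\: T)); rewrite expr2.
  set x := (-1) ^+ _; set y := (-1) ^+ _; set z := (-1) ^+ _ => e1.
  by transitivity (x * x * (y * z * a (i |: T) * b (S :\: T))); [ring|rewrite e1; ring].
have iT : i \notin T by apply: contra iS; exact: (subsetP TS).
have iU : i \notin S :\: T by rewrite inE (negPf iS) andbF.
have -> : (i |: S) :\: T = i |: (S :\: T).
  by apply/setP => j; rewrite !inE; case: eqP => //= ->; rewrite iT.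
rewrite ffunE (negPf iU).
have eS : S = T :|: S :\: T by rewrite -{1}(setID S T) (setIidPr TS).
have dTU : [disjoint T & S :\: T].
  by rewrite -setI_eq0; apply/eqP/setP => j; rewrite !inE; case: (j \in T).
case: (eqVneq (a T) 0) => [->|/ha <-]; first by rewrite !(mul0r, mulr0).
rewrite -[#|T|]mul1n -(cards1 i) -(inv_count_swap (dset1 _ iT)).
rewrite {1}eS !inv_countUr ?dset1// !exprD.
have := sqrr_sign F (inv_count [set i] T); rewrite expr2 => e1; ring.
Qed.

Lemma contr_antiderivation p X a b : homog p a ->
  contr X (a * b) = contr X a * b + (-1) ^+ p *: (a * contr X b).
Proof.
move=> ha; rewrite !contrE mulr_suml mulr_sumr scaler_sumr -big_split.
apply: eq_bigr => i _ /=; rewrite (contriM _ _ ha) scalerDr scalerAl.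
by rewrite scalerA [_ * (-1) ^+ p]mulrC -scalerA scalerAr.
Qed.


Lemma ce_d_is_linear g : linear (ce_d g).
Proof.
move=> x a b; rewrite /ce_d scaler_sumr -big_split; apply: eq_bigr => p _ /=.
by rewrite contr_is_linear mulrDr scalerAr.
Qed.

Lemma ce_d_leibniz g p a b : homog p a ->
  ce_d g (a * b) = ce_d g a * b + (-1) ^+ p *: (a * ce_d g b).
Proof.
move=> ha; rewrite /ce_d mulr_suml mulr_sumr scaler_sumr -big_split.
apply: eq_bigr => q _ /=; rewrite (contr_antiderivation _ _ ha) mulrDr mulrA.
rewrite -scalerAr !mulrA; congr (_ + _ *: (_ * _)).
by rewrite (wedgeC (@homog_ce_d1 _ _) ha) mulnC exprM sqrr_sign scale1r.
Qed.

Lemma contr_covec X xi : contr X (covec xi) = (xi *m X) 0 0 *: 1.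
Proof.
apply/ffunP => S; rewrite !ffunE mxE; case: (eqVneq S set0) => [->|S0].
  rewrite mulr1; apply: eq_big => [i|i _]; first by rewrite inE.
  rewrite ffunE setU0 inv_count0r expr0 mul1r mulrC (big_pred1 i)// => j.
  by rewrite /= (inj_eq set1_inj).
rewrite mulr0 big1// => i iS; rewrite ffunE big_pred0 ?mulr0// => j.
apply/eqP => /setP e; have [k kS] := set0Pn _ S0.
have := e k; rewrite !inE kS orbT => /esym/eqP ejk.
have := e i; rewrite !inE eqxx /= => /esym/eqP eji.
by rewrite eji -ejk kS in iS.
Qed.

Lemma ce_d1_is_linear g : linear (ce_d1 g).
Proof.
move=> x xi eta; rewrite /ce_d1 scalerN -opprD scaler_sumr -big_split.
congr (- _); apply: eq_bigr => i _; rewrite scaler_sumr -big_split.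
apply: eq_bigr => j _; rewrite /= mulmxDl -scalemxAl !mxE.
by rewrite scalerDl scalerA.
Qed.

HB.instance Definition _ g :=
  GRing.isLinear.Build F 'rV[F]_m (ext F m) *:%R (ce_d1 g) (ce_d1_is_linear g).

Lemma ce_d_covec g xi : ce_d g (covec xi) = ce_d1 g xi.
Proof.
rewrite [in RHS](row_sum_delta xi) linear_sum; apply: eq_bigr => p _ /=.
by rewrite linearZ /= contr_covec -colE mxE -scalerAr mulr1.
Qed.

Lemma lie_anti g X Y : g Y X = - g X Y.
Proof.
have DL Z U V : g (U + V) Z = g U Z + g V Z.
  by have := lie_linear_l g Z 1 U V; rewrite /= !scale1r.
have DR Z U V : g Z (U + V) = g Z U + g Z V.
  by have := lie_linear_r g Z 1 U V; rewrite /= !scale1r.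
apply/eqP; rewrite -addr_eq0; apply/eqP.
by have := lie_alt g (X + Y); rewrite DL !DR !lie_alt add0r addr0 addrC.
Qed.

Lemma lie_suml g (I : Type) (r : seq I) (x : I -> F) (f : I -> 'cV[F]_m) Y :
  g (\sum_(i <- r) x i *: f i) Y = \sum_(i <- r) x i *: g (f i) Y.
Proof.
have g0 : g 0 Y = 0.
  by have := lie_linear_l g Y (-1) 0 0; rewrite /= !scaleN1r oppr0 addr0 addNr.
elim: r => [|i r IH]; first by rewrite !big_nil.
by rewrite !big_cons (lie_linear_l g Y) IH.
Qed.

Lemma lie_sumr g (I : Type) (r : seq I) (x : I -> F) (f : I -> 'cV[F]_m) X :
  g X (\sum_(i <- r) x i *: f i) = \sum_(i <- r) x i *: g X (f i).
Proof.
rewrite lie_anti lie_suml -sumrN; apply: eq_bigr => i _.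
by rewrite -scalerN lie_anti opprK.
Qed.

Lemma ce_d_eval g xi X Y :
  contr Y (contr X (ce_d g (covec xi))) = - (xi *m g X Y) 0 0 *: 1.
Proof.
have contr2 i j : contr Y (contr X (covec (delta_mx 0 i) * covec (delta_mx 0 j))) =
    (X i 0 * Y j 0 - X j 0 * Y i 0) *: 1.
  rewrite (contr_antiderivation _ _ (@homog_covec _)) !contr_covec -!rowE !mxE.
  rewrite expr1 scaleN1r -scalerAr -scalerAl mulr1 mul1r linearB !linearZ /=.
  by rewrite !contr_covec -!rowE !mxE scalerN scalerBl !scalerA.
have eX : X = \sum_i X i 0 *: delta_mx i 0.
  by rewrite {1}(matrix_sum_delta X); apply: eq_bigr => i _; rewrite big_ord1.
have eY : Y = \sum_i Y i 0 *: delta_mx i 0.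
  by rewrite {1}(matrix_sum_delta Y); apply: eq_bigr => i _; rewrite big_ord1.
rewrite ce_d_covec /ce_d1 !linearN scaleNr; congr (- _).
rewrite {2}eX {2}eY lie_suml mulmx_sumr summxE !linear_sum scaler_suml /=.
pose c (i j : 'I_m) := (xi *m g (delta_mx i 0) (delta_mx j 0)) 0 0.
have cN i j : c j i = - c i j by rewrite /c lie_anti mulmxN mxE.
have c0 i : c i i = 0 by rewrite /c lie_alt mulmx0 mxE.
transitivity (\sum_(i < m) \sum_(j < m | (i < j)%N) (c i j * (X i 0 * Y j 0)) *: (1 : ext F m)
   + \sum_(i < m) \sum_(j < m | (i < j)%N) (c j i * (X j 0 * Y i 0)) *: (1 : ext F m)).
  rewrite -big_split; apply: eq_bigr => i _ /=.
  rewrite !linear_sum -big_split /=; apply: eq_bigr => j _ /=.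
  rewrite !linearZ /= contr2 scalerA -scalerDl (cN i j); congr (_ *: _); rewrite /c; ring.
rewrite [X in _ + X](exchange_big_dep xpredT)//= -big_split /=.
apply: eq_bigr => i _.
rewrite lie_sumr scaler_sumr mulmx_sumr summxE scaler_suml.
have -> : \sum_j (xi *m (X i 0 *: (Y j 0 *: g (delta_mx i 0) (delta_mx j 0)))) 0 0 *: (1 : ext F m)
  = \sum_j (c i j * (X i 0 * Y j 0)) *: (1 : ext F m).
  by apply: eq_bigr => j _; rewrite -!scalemxAr !(mxE scalemx_key) /c mulrA mulrC.
rewrite [RHS](bigID (fun j : 'I_m => (i < j)%N)) /=; congr (_ + _).
rewrite [RHS](bigD1 i) ?ltnn//= c0 mul0r scale0r add0r.
by apply: eq_bigl => j; rewrite -leqNgt ltn_neqAle andbC.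
Qed.

Lemma ce_d_one g : ce_d g 1 = 0.
Proof.
rewrite /ce_d big1// => p _; rewrite (_ : contr _ _ = 0) ?mulr0//.
apply/ffunP => S; rewrite !ffunE big1// => i iS.
by rewrite ffunE -cards_eq0 cardsU1 iS !mulr0.
Qed.

End ExteriorCalculus.

Section Complexification.
Variables (R : rcfType) (m : nat) (g : lieAlgebra R m).

Definition cplx_br (x y : 'cV[R[i]]_m) : 'cV[R[i]]_m :=
  \sum_i \sum_j (x i 0 * y j 0) *:
    map_mx (real_complex R) (g (delta_mx i 0) (delta_mx j 0)).

Let toC : 'cV[R]_m -> 'cV[R[i]]_m := map_mx (real_complex R).

Fact cplx_linear_l y : linear (cplx_br^~ y).
Proof.
move=> c x z; rewrite /cplx_br scaler_sumr -big_split; apply: eq_bigr => i _ /=.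
rewrite scaler_sumr -big_split; apply: eq_bigr => j _ /=.
by rewrite !mxE mulrDl scalerDl scalerA mulrA.
Qed.

Fact cplx_linear_r x : linear (cplx_br x).
Proof.
move=> c y z; rewrite /cplx_br scaler_sumr -big_split; apply: eq_bigr => i _ /=.
rewrite scaler_sumr -big_split; apply: eq_bigr => j _ /=.
by rewrite !mxE mulrDr scalerDl scalerA mulrCA.
Qed.

Fact cplx_br_real u v : cplx_br (toC u) (toC v) = toC (g u v).
Proof.
have eu (w : 'cV[R]_m) : w = \sum_i w i 0 *: delta_mx i 0.
  by rewrite {1}(matrix_sum_delta w); apply: eq_bigr => i _; rewrite big_ord1.
rewrite {2}(eu u) {2}(eu v) lie_suml /toC raddf_sum; apply: eq_bigr => i _ /=.
rewrite map_mxZ lie_sumr raddf_sum scaler_sumr; apply: eq_bigr => j _ /=.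
by rewrite map_mxZ scalerA !mxE.
Qed.

Let decomp x : exists u v, x = 'i%C *: toC v + toC u.
Proof.
exists (map_mx (@complex.Re R) x), (map_mx (@complex.Im R) x); apply/matrixP => i j.
by rewrite !mxE addrC -complexE.
Qed.

Fact cplx_alt x : cplx_br x x = 0.
Proof.
have [u [v ->]] := decomp x.
rewrite cplx_linear_l !cplx_linear_r !cplx_br_real !lie_alt (lie_anti g u v).
by rewrite /toC raddfN raddf0 /= scaler0 add0r addr0 scalerN addNr.
Qed.

Fact cplx_jacobi x y z :
  cplx_br x (cplx_br y z) + cplx_br y (cplx_br z x) + cplx_br z (cplx_br x y) = 0.
Proof.
pose jac x y z := cplx_br x (cplx_br y z) + cplx_br y (cplx_br z x) + cplx_br z (cplx_br x y).
have jacC a b c : jac a b c = jac b c a.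
  by rewrite /jac -addrA addrC.
have jacL c a a' b d : jac (c *: a + a') b d = c *: jac a b d + jac a' b d.
  rewrite /jac !(cplx_linear_l, cplx_linear_r) !scalerDr.
  by move: (c *: _) (c *: _) (c *: _) => r q p; rewrite (addrACA p) (addrACA (p + _)).
have jac0 a b c : jac (toC a) (toC b) (toC c) = 0.
  by rewrite /jac !cplx_br_real -!raddfD lie_jacobi raddf0.
rewrite -/(jac x y z).
have [u [v ->]] := decomp x; have [u' [v' ->]] := decomp y.
have [u'' [v'' ->]] := decomp z.
rewrite jacL !(jacC (toC _)) !jacL !(jacC (toC _) (_ + _)) !jacL !jac0.
by rewrite !(scaler0, addr0).
Qed.

Definition complexify : lieAlgebra R[i] m :=
  LieAlgebra cplx_linear_l cplx_linear_r cplx_alt cplx_jacobi.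

Lemma complexify_delta i j :
  complexify (delta_mx i 0) (delta_mx j 0) =
  map_mx (real_complex R) (g (delta_mx i 0) (delta_mx j 0)).
Proof. by rewrite -[RHS]/(toC _) -cplx_br_real /toC !map_delta_mx. Qed.

End Complexification.

(* The semidirect product R e_0 |x_A R^p, with [e_0, v] = A v on the abelian
   ideal R^p = <e_1, ..., e_p>. *)
Section Semidirect.
Variables (F : comNzRingType) (p : nat) (A : 'M[F]_p).
Implicit Types x y z : 'cV[F]_(1 + p).

Definition semidirect_br x y : 'cV[F]_(1 + p) :=
  col_mx 0 (usubmx x 0 0 *: (A *m dsubmx y) - usubmx y 0 0 *: (A *m dsubmx x)).

Fact semidirect_linear_l y : linear (semidirect_br^~ y).
Proof.
move=> c x z; rewrite /semidirect_br scale_col_mx add_col_mx scaler0 addr0.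
congr col_mx; rewrite !linearD !linearZ /= !mxE.
by rewrite scalerDl !scalerA (mulrC c) addrACA.
Qed.

Fact semidirect_linear_r x : linear (semidirect_br x).
Proof.
move=> c y z; have anti u : semidirect_br x u = - semidirect_br u x.
  by rewrite /semidirect_br opp_col_mx oppr0 opprB.
by rewrite !anti semidirect_linear_l opprD scalerN.
Qed.

Fact semidirect_alt x : semidirect_br x x = 0.
Proof. by rewrite /semidirect_br subrr col_mx0. Qed.

Fact semidirect_jacobi x y z :
  semidirect_br x (semidirect_br y z) + semidirect_br y (semidirect_br z x) +
  semidirect_br z (semidirect_br x y) = 0.
Proof.
rewrite /semidirect_br !col_mxKu !col_mxKd !mxE !scale0r !subr0 !add_col_mx !addr0.
rewrite -[RHS]col_mx0; congr col_mx.
rewrite !mulmxBr -!scalemxAr !scalerBr !scalerA.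
move: (A *m (A *m dsubmx x)) (A *m (A *m dsubmx y)) (A *m (A *m dsubmx z)).
by move=> u v w; apply/matrixP => i j; rewrite !mxE; ring.
Qed.

Definition semidirect : lieAlgebra F (1 + p) :=
  LieAlgebra semidirect_linear_l semidirect_linear_r
             semidirect_alt semidirect_jacobi.

End Semidirect.

Notation "A \oplus B" := (block_mx A 0 0 B) (at level 50, left associativity).

Section MatrixBlocks.
Variable F : comNzRingType.

Definition jordan_block (r : nat) (t : F) : 'M[F]_r :=
  \matrix_(i, j) (t *+ (i == j) + (i.+1 == j)%:R).

Definition rot_block (a b : F) : 'M[F]_2 :=
  block_mx (a%:M : 'M_1) (- b)%:M b%:M a%:M.

Definition scalar_block (t : F) : 'M[F]_1 := t%:M.

Definition diag5 (t1 t2 t3 t4 t5 : F) : 'M[F]_5 :=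
  diag_mx (\row_(i < 5) nth 0 [:: t1; t2; t3; t4; t5] i).

End MatrixBlocks.

Section GeneralizedComplex.
Variable m : nat.

(* Elements X + xi of the direct sum of g and its dual. *)
Section DoubleSpace.
Variable F : fieldType.
Implicit Types (v w : 'cV[F]_(m + m)) (g : lieAlgebra F m) (rho : ext F m).

Definition gpair (X : 'cV[F]_m) (xi : 'rV[F]_m) : 'cV[F]_(m + m) := col_mx X xi^T.
Definition gvec v : 'cV[F]_m := usubmx v.
Definition gcov v : 'rV[F]_m := (dsubmx v)^T.

Definition pairing v w : F :=
  2%:R^-1 * ((gcov v *m gvec w) 0 0 + (gcov w *m gvec v) 0 0).

Definition ad_star g (X : 'cV[F]_m) (eta : 'rV[F]_m) : 'rV[F]_m :=
  \row_j - (eta *m g X (delta_mx j 0)) 0 0.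

Definition dorfman g v w : 'cV[F]_(m + m) :=
  gpair (g (gvec v) (gvec w))
        (ad_star g (gvec v) (gcov w) - ad_star g (gvec w) (gcov v)).

Definition clifford v rho : ext F m :=
  contr (gvec v) rho + covec (gcov v) * rho.

End DoubleSpace.

Variable R : rcfType.
Implicit Types (g : lieAlgebra R m) (J : 'M[R]_(m + m)) (rho a : ext R[i] m).

(* The 'i-eigenspace of J in the complexification. *)
Definition in_L J (v : 'cV[R[i]]_(m + m)) : Prop :=
  map_mx (real_complex R) J *m v = 'i *: v.

Definition is_gcs g J : Prop :=
  [/\ J *m J = - 1%:M,
      forall v w : 'cV[R]_(m + m), pairing (J *m v) (J *m w) = pairing v w
    & forall v w, in_L J v -> in_L J w ->
        in_L J (dorfman (complexify g) v w)].

(* rho generates the line K_L, i.e., L is the annihilator of rho. *)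
Definition generates J rho : Prop :=
  rho != 0 /\ forall v, clifford v rho = 0 <-> in_L J v.

Definition conj_form a : ext R[i] m := [ffun S : {set 'I_m} => (a S)^*].

Definition real_2form a : Prop := homog 2 a /\ conj_form a = a.

(* rho = exp(B + i omega) ^ Omega with Omega = theta_1 ^ ... ^ theta_k, the rows
   of theta being linearly independent one-forms.  The scalar c only matters
   for k = 0, where Omega is a nonzero constant; m = 2n is the dimension. *)
Definition has_type (k : nat) rho : Prop :=
  exists (B omega : ext R[i] m) (c : R[i]) (theta : 'M[R[i]]_(k, m)),
    let Omega := c *: \prod_(j < k) covec (row j theta) in
    [/\ [/\ real_2form B, real_2form omega, c != 0 & row_free theta],
        rho = ext_exp (B + 'i *: omega) * Omega
      & omega ^+ (m./2 - k) * Omega * conj_form Omega != 0].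

Definition defines_gcs g (k : nat) rho : Prop :=
  exists J, [/\ is_gcs g J, generates J rho & has_type k rho].

End GeneralizedComplex.

(* The basis covector e^i, i = 0, ..., 5, of the dual of R e_0 |x_A R^5. *)
Definition e {R : rcfType} (i : 'I_6) : ext R[i] 6 := covec (delta_mx 0 i).

Lemma ce_d_semidirect0 (R : rcfType) (A : 'M[R]_5) :
  ce_d (complexify (semidirect A)) (e 0) = 0.
Proof.
rewrite ce_d_covec /ce_d1 big1 ?oppr0// => i _; rewrite big1// => j _.
have -> : (0 : 'I_6) = lshift 5 (0 : 'I_1) by apply: val_inj.
rewrite complexify_delta -rowE 2!mxE.
rewrite /semidirect /= /semidirect_br col_mxEu mxE.
by rewrite rmorph0 scale0r.
Qed.

Lemma ce_d_semidirectS (R : rcfType) (A : 'M[R]_5) (p : 'I_5) :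
  ce_d (complexify (semidirect A)) (e (rshift 1 p)) =
  - (e 0 * \sum_i (A p i)%:C%C *: e (rshift 1 i)).
Proof.
rewrite ce_d_covec /ce_d1 big_ord_recl [X in _ + X]big1 ?addr0 => [|i _].
  rewrite mulr_sumr big_mkcond big_ord_recl /= add0r; congr (- _).
  apply: eq_bigr => j _; rewrite -!rshift1 -scalerAr.
  rewrite [cplx_br _ _ _]complexify_delta -rowE 2!mxE /=.
  have -> : (ord0 : 'I_6) = lshift 5 (0 : 'I_1) by apply: val_inj.
  have e0E : (0 : 'I_6) = lshift 5 (0 : 'I_1) by apply: val_inj.
  rewrite /semidirect_br col_mxEd /e e0E; congr (_%:C%C *: _).
  have -> : dsubmx (delta_mx (rshift 1 j) 0 : 'cV[R]_(1 + 5)) = delta_mx j 0.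
    by apply/matrixP => k l; rewrite !mxE (inj_eq (@rshift_inj _ _)).
  by rewrite -colE !mxE !eqxx mul1r mul0r subr0.
rewrite big1// => j; case: (unliftP ord0 j) => [j' ->|-> //] _.
rewrite -!rshift1 complexify_delta /= /semidirect_br ![usubmx _ _ _]mxE.
by rewrite ![delta_mx _ _ _ _]mxE !scale0r subrr col_mx0 map_mx0 mulmx0 mxE scale0r.
Qed.

(* The conclusion for one row of the table: [Lambda] and [c] are the listed
   constants, for rho = exp('i omega) ^ Omega of type k. *)
Definition row_claim (R : rcfType) (A : 'M[R]_5) (k : nat)
    (Omega omega : ext R[i] 6) (Lambda c : R[i]) : Prop :=
  let g := semidirect A in
  let d := ce_d (complexify g) in
  let rho := ext_exp ('i *: omega) * Omega in
  [/\ defines_gcs g k rho,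
      d rho = - Lambda *: (e 0 * rho),
      omega ^+ (3 - k) * Omega * conj_form Omega =
        c *: (e 0 * e 1 * e 2 * e 3 * e 4 * e 5),
      c != 0
    & d rho = 0 <-> Lambda = 0].

(* Eigenvalue lists are compared as multisets ([perm_eq]); "two pairs" use
   disjoint occurrences. *)
Section Pairs.
Variable R : rcfType.
Implicit Types (s t : seq R) (a b la mu nu ga : R).

Definition identical_pair s :=
  exists r t, perm_eq s [:: r, r & t].
Definition opposite_pair s :=
  exists r t, perm_eq s [:: r, - r & t].
Definition two_identical_pairs s :=
  exists r q t, perm_eq s [:: r, r, q, q & t].
Definition two_opposite_pairs s :=
  exists r q t, perm_eq s [:: r, - r, q, - q & t].

Definition pattern_J3 la mu nu := la != 0 \/ mu != - nu.

Definition pattern_J2J2 la mu nu :=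
  [/\ la != mu, la != - mu
    & forall al, ~ perm_eq [:: la; mu; nu] [:: 0; - al; al]].

Definition pattern_J2 la mu nu ga :=
  [/\ ~ two_identical_pairs [:: la; mu; nu; ga],
      ~ two_opposite_pairs [:: la; mu; nu; ga]
    & la = 0 -> ~ opposite_pair [:: mu; nu; ga]].

Definition pattern_CJ3 a la := (a, la) != (0, 0).

Definition pattern_CJ2 a la mu :=
  la != mu /\ (a = 0 -> la != - mu /\ la != 0).

Definition pattern_C a la mu nu :=
  ~ identical_pair [:: la; mu; nu] /\
  (a = 0 -> ~ opposite_pair [:: la; mu; nu]).

Definition pattern_diag s :=
  ~ two_identical_pairs s /\ ~ two_opposite_pairs s.

End Pairs.

(* Main.v *)
From HB Require Import structures.
Require Import Defs.
From mathcomp Require Import all_boot all_order all_algebra complex reals ring.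
Import Order.TTheory GRing.Theory Num.Theory.
Local Open Scope ring_scope.

(** A complex form rho = exp(i omega) ^ Omega, with omega a real 2-form and
    Omega a product of k one-forms, determines the subspace L of those v in the
    complexified double of g with v . rho = 0.  The rows of the table are
    instances of one theorem, [pure_spinor_defines_gcs]: if
    omega^(n-k) ^ Omega ^ conj(Omega) is not zero and d rho = u ^ rho for some
    covector u, then L is the eigenspace of a generalized complex structure of
    type k.  Its proof has three parts.

    - Nondegeneracy ([spinor_nondegenerate]).  If v = X + xi and its conjugate
      both annihilate rho, then X contracts omega^(n-k) ^ Omega ^ conj(Omega)
      to zero, and a nonzero top-degree form admits this only for X = 0; then
      xi divides both Omega and conj(Omega), whose product would vanish if xi
      did not.  Hence L meets its conjugate in 0.

    - Dimension and reality.  Completing the factors of Omega to a basis of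
      covectors exhibits half as many independent elements of L as the double
      has dimensions ([spinor_eigenbasis]).  With nondegeneracy, the double is
      the direct sum of L and its conjugate, and the operator acting by i and
      -i on the summands is real; it is orthogonal because L is isotropic, a
      consequence of the Clifford relation ([clifford_anticomm]).

    - Integrability.  The bracket is a derived bracket:
      [[v, w]] acts on forms as [[d, v], w] ([derived_bracket]).  So if v and w
      annihilate rho and d rho = u ^ rho, then [[v, w]] . rho =
      - w . v . (u ^ rho), which is a multiple of w . rho, that is, 0.

    For a row of the table it remains to check identities between explicit
    forms on R e_0 |x R^5.  Since exp(i omega) is central and d obeys the
    Leibniz rule, d rho = - Lambda e^0 ^ rho follows from d omega ^ Omega = 0 and
    d Omega = - Lambda e^0 ^ Omega, and together with the volume identity these
    only involve the finitely many monomials in e^0, ..., e^5.  They are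
    verified by computing with linear combinations of sorted monomials and
    comparing coefficients as polynomials in i and the parameters.  That rho is
    closed only for Lambda = 0 means e^0 ^ rho <> 0, which is nondegeneracy
    applied to the real covector e^0. *)

Set Implicit Arguments.
Unset Strict Implicit.
Unset Printing Implicit Defensive.

(** * The exterior algebra: generators, degrees and contractions *)

Section ExteriorAlgebraFacts.
Context {F : comNzRingType} {m : nat}.
Implicit Types (a b c : ext F m) (X Y : 'cV[F]_m) (xi eta : 'rV[F]_m).

Fact covec_is_linear : linear (@covec F m).
Proof.
move=> x xi eta; apply/ffunP => S; rewrite !ffunE mulr_sumr -big_split.
by apply: eq_bigr => i _; rewrite !mxE.
Qed.

HB.instance Definition _ :=
  GRing.isLinear.Build F 'rV[F]_m (ext F m) *:%R (@covec F m) covec_is_linear.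

Lemma covec_deltaE i (S : {set 'I_m}) :
  covec (delta_mx 0 i) S = (S == [set i])%:R :> F.
Proof.
rewrite ffunE big_mkcond (bigD1 i)//= big1 ?addr0 => [|j ji].
  by rewrite mxE !eqxx; case: eqP.
by rewrite mxE eqxx (negPf ji); case: eqP.
Qed.

(** Every form is a combination of products of covectors: identities between
    linear operators on forms need only be checked on 1 and propagated through
    the product with a covector. *)
Lemma ext_ind (P : ext F m -> Prop) :
    (forall x a b, P a -> P b -> P (x *: a + b)) -> P 1 ->
    (forall xi a, P a -> P (covec xi * a)) ->
  forall a, P a.
Proof.
move=> PD P1 PM a.
have P0 : P 0 by rewrite -(addNr 1) -scaleN1r; apply: PD.
have PZ x b : P b -> P (x *: b) by move=> Pb; rewrite -[_ *: _]addr0; apply: PD.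
pose d S : ext F m := [ffun T => (T == S)%:R].
have dU1 i (S : {set 'I_m}) : i \notin S ->
    d (i |: S) = (-1) ^+ inv_count [set i] S *: (covec (delta_mx 0 i) * d S).
  move=> iS; apply/ffunP => T; rewrite !ffunE.
  rewrite (eq_bigr (fun U => (-1) ^+ inv_count U (T :\: U) *
      ((U == [set i])%:R * (T :\: U == S)%:R))); last first.
    by move=> U _; rewrite covec_deltaE !ffunE.
  case: (boolP (i \in T)) => iT; last first.
    rewrite big1 ?mulr0.
      by case: eqP => // eT; rewrite eT setU11 in iT.
    move=> U UT; case: eqP => [eU|]; last by rewrite mul0r mulr0.
    by rewrite eU sub1set (negPf iT) in UT.
  rewrite (bigD1 [set i]) ?sub1set//= big1 ?addr0; last first.
    by move=> U /andP[_ /negPf->]; rewrite mul0r mulr0.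
  rewrite eqxx mul1r; case: (eqVneq (T :\ i) S) => [<-|TS].
    by rewrite setD1K// eqxx mulr1 -expr2 sqrr_sign.
  rewrite !mulr0; case: eqP => // eT; case/eqP: TS.
  by rewrite eT setU1K.
have Pd S : P (d S).
  have [n] := ubnP #|S|; elim: n S => // n IH S.
  have [->|[i iS]] := set_0Vmem S.
    by move=> _; rewrite (_ : d _ = 1)//; apply/ffunP => T; rewrite !ffunE.
  rewrite (cardsD1 i) iS add1n ltnS => Sn.
  by rewrite -(setD1K iS) dU1 ?setD11//; apply/PZ/PM/IH.
have -> : a = \sum_S a S *: d S.
  apply/ffunP => T; rewrite sum_ffunE (bigD1 T)//= big1 ?addr0.
    by rewrite !ffunE eqxx mulr1.
  by move=> S ST; rewrite !ffunE eq_sym (negPf ST) mulr0.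
elim/big_rec: _ => [//|S x _ Px]; exact: PD.
Qed.

Lemma homog_gt p a : homog p a -> (m < p)%N -> a = 0.
Proof.
move=> ha mp; apply/ffunP => S; rewrite ffunE; apply: contraTeq mp.
by move=> /ha <-; rewrite -leqNgt -[X in (_ <= X)%N]card_ord max_card.
Qed.

Lemma homog1 : homog 0 (1 : ext F m).
Proof.
by move=> S; rewrite ffunE; case: (eqVneq S set0) => [->|]; rewrite ?cards0 ?eqxx.
Qed.

Lemma homogX p a n : homog p a -> homog (n * p) (a ^+ n).
Proof.
move=> ha; elim: n => [|n IH]; first exact: homog1.
by rewrite exprS mulSn; apply: homogM.
Qed.

Lemma contr_card p X a (S : {set 'I_m}) :
  homog p a -> contr X a S != 0 -> #|S|.+1 = p.
Proof.
move=> ha; rewrite ffunE; apply: contra_neq_eq => Sp.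
rewrite big1// => i iS; have [->|/ha] := eqVneq (a (i |: S)) 0.
  by rewrite !mulr0.
by rewrite cardsU1 iS add1n => e; rewrite e eqxx in Sp.
Qed.

Lemma homog_contr p X a : homog p.+1 a -> homog p (contr X a).
Proof. by move=> ha S /(contr_card ha)[]. Qed.

Lemma homog1_covec a : homog 1 a -> a = covec (\row_i a [set i]).
Proof.
move=> ha; apply/ffunP => S; rewrite ffunE.
have [/cards1P[i ->]|S1] := boolP (#|S| == 1%N).
  rewrite (big_pred1 i) ?mxE// => j /=.
  by rewrite (inj_eq set1_inj) eq_sym.
rewrite big_pred0.
  by apply: contraNeq S1 => /ha ->.
by move=> i; apply: contraNF S1 => /eqP->; rewrite cards1.
Qed.

(** Forms supported in different degrees can only cancel by vanishing: the
    interior product lowers the degree and the exterior product raises it. *)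
Lemma contr_covec_eq0 p X xi a : homog p a ->
  contr X a + covec xi * a = 0 -> contr X a = 0 /\ covec xi * a = 0.
Proof.
move=> ha e; have hb := homogM (@homog_covec _ _ xi) ha.
suff e1 : contr X a = 0 by split=> //; rewrite e1 add0r in e.
apply/ffunP => S; rewrite [RHS]ffunE; apply/eqP/negPn/negP => cS.
have hS := contr_card ha cS.
have bS : (covec xi * a) S = 0.
  apply/eqP/negPn/negP => /hb; rewrite -hS => /eqP.
  by rewrite add1n ltn_eqF.
have : (contr X a + covec xi * a) S = 0 by rewrite e ffunE.
by rewrite [LHS]ffunE bS addr0 => h; rewrite h eqxx in cS.
Qed.

Lemma contrB X a b : contr X (a - b) = contr X a - contr X b.
Proof. exact: linearB. Qed.

Lemma contrZ X x a : contr X (x *: a) = x *: contr X a.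
Proof. exact: linearZ. Qed.

Lemma contr1 X : contr X 1 = 0.
Proof.
apply/ffunP => S; rewrite [RHS]ffunE; apply/eqP/negPn/negP.
by move/(contr_card homog1).
Qed.

Lemma covec_antiC xi eta a :
  covec xi * (covec eta * a) = - (covec eta * (covec xi * a)).
Proof.
by rewrite !mulrA (wedgeC (@homog_covec _ _ xi) (@homog_covec _ _ eta))
  expr1 scaleN1r mulNr.
Qed.

(** Anticommutativity alone only gives twice the claim; over a ring where 2 may
    be a zero divisor, the off-diagonal terms have to be cancelled in pairs. *)
Lemma covec_sq xi : covec xi * covec xi = 0.
Proof.
have anti (i j : 'I_m) : covec (delta_mx 0 i) * covec (delta_mx 0 j) =
    - (covec (delta_mx 0 j) * covec (delta_mx 0 i)) :> ext F m.
  by rewrite -[X in X = _]mulr1 -mulrA covec_antiC mulr1.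
have sq (i : 'I_m) : covec (delta_mx 0 i) * covec (delta_mx 0 i) = 0 :> ext F m.
  apply/ffunP => S; rewrite !ffunE big1// => T TS; rewrite !covec_deltaE.
  case: eqP => [->|]; last by rewrite mul0r mulr0.
  case: eqP => [/setP/(_ i)|]; last by rewrite !mulr0.
  by rewrite !inE eqxx.
rewrite [xi]row_sum_delta linear_sum mulr_suml.
pose f i j : ext F m :=
  (xi 0 i * xi 0 j) *: (covec (delta_mx 0 i) * covec (delta_mx 0 j)).
rewrite (eq_bigr (fun i : 'I_m => \sum_(j < m) f i j)) => [|i _]; last first.
  rewrite mulr_sumr; apply: eq_bigr => j _.
  by rewrite /f !linearZ /= -scalerAr -scalerAl scalerA mulrC.
(* The diagonal terms vanish; those with i < j cancel those with j < i. *)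
rewrite (eq_bigr (fun i : 'I_m => \sum_(j < m | (i < j)%N) f i j +
    \sum_(j < m | (j < i)%N) f i j)) => [|i _].
  rewrite big_split /= [X in _ + X](exchange_big_dep xpredT)//= -big_split /=.
  rewrite big1// => i _; rewrite -big_split big1// => j _ /=.
  by rewrite /f anti mulrC scalerN addNr.
rewrite (bigID (fun j : 'I_m => (i < j)%N)) /=; congr (_ + _).
rewrite (bigD1 i) ?ltnn//= /f sq scaler0 add0r.
by apply: eq_bigl => j; rewrite -leqNgt ltn_neqAle andbC.
Qed.

Lemma covec_sqM xi a : covec xi * (covec xi * a) = 0.
Proof. by rewrite mulrA covec_sq mul0r. Qed.

Lemma contr_covecM X xi a :
  contr X (covec xi * a) = (xi *m X) 0 0 *: a - covec xi * contr X a.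
Proof.
rewrite (contr_antiderivation _ _ (@homog_covec _ _ xi)) contr_covec.
by rewrite -scalerAl mul1r expr1 scaleN1r.
Qed.

Lemma contr_antiC X Y a : contr X (contr Y a) = - contr Y (contr X a).
Proof.
elim/ext_ind: a => [x a b IHa IHb||xi a IH].
- by rewrite !linearP /= IHa IHb.
- by rewrite !contr1 !linear0.
- rewrite !contr_covecM !contrB !contrZ.
  by rewrite !contr_covecM IH mulrN !opprB addrA.
Qed.

(** Degree-two elements are central, as they commute with each covector. *)
Lemma homog2C a b : homog 2 a -> a * b = b * a.
Proof.
move=> ha; elim/ext_ind: b => [x b c IHb IHc||xi b IH].
- by rewrite mulrDl mulrDr -scalerAl -scalerAr IHb IHc.
- by rewrite mulr1 mul1r.
- rewrite mulrA (wedgeC ha (@homog_covec _ _ xi)) muln1 -signr_odd expr0 scale1r.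
  by rewrite -!mulrA IH.
Qed.

End ExteriorAlgebraFacts.

(** * The Clifford action and the derived bracket *)

Section DerivedBracket.
Context {F : fieldType} {m : nat} (g : lieAlgebra F m).
Implicit Types (a b : ext F m) (X Y : 'cV[F]_m) (xi eta : 'rV[F]_m).
Implicit Types (v w : 'cV[F]_(m + m)).

HB.instance Definition _ :=
  GRing.isLinear.Build F (ext F m) (ext F m) *:%R (ce_d g) (ce_d_is_linear g).

Lemma ce_dD a b : ce_d g (a + b) = ce_d g a + ce_d g b.
Proof. exact: linearD. Qed.

Lemma ce_dB a b : ce_d g (a - b) = ce_d g a - ce_d g b.
Proof. exact: linearB. Qed.

Lemma ce_dZ x a : ce_d g (x *: a) = x *: ce_d g a.
Proof. exact: linearZ. Qed.

Lemma contrD X a b : contr X (a + b) = contr X a + contr X b.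
Proof. exact: linearD. Qed.

Lemma ce_d_covecM xi a :
  ce_d g (covec xi * a) = ce_d1 g xi * a - covec xi * ce_d g a.
Proof.
by rewrite (ce_d_leibniz _ _ (@homog_covec _ _ xi)) ce_d_covec expr1 scaleN1r.
Qed.

(** This is the Lie derivative of xi along X: the other term of Cartan's formula,
    d (iota_X xi), vanishes because xi(X) is a constant. *)
Lemma contr_ce_d1 X xi : contr X (ce_d1 g xi) = covec (ad_star g X xi).
Proof.
have h1 := homog_contr (X := X) (@homog_ce_d1 _ _ g xi).
rewrite (homog1_covec h1); congr covec; apply/rowP => j.
have := ce_d_eval g xi X (delta_mx j 0).
rewrite ce_d_covec {1}(homog1_covec h1) contr_covec -colE [in LHS]mxE.
move/(congr1 (fun f : ext F m => f set0)); rewrite !ffunE.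
by rewrite eqxx !mulr1 => ->; rewrite [RHS]mxE.
Qed.

Lemma contr_ce_d1M X xi a :
  contr X (ce_d1 g xi * a) = covec (ad_star g X xi) * a + ce_d1 g xi * contr X a.
Proof.
rewrite (contr_antiderivation _ _ (@homog_ce_d1 _ _ g xi)) contr_ce_d1.
by rewrite sqrrN expr1n scale1r.
Qed.

Lemma ad_star_mul X Y xi : (ad_star g X xi *m Y) 0 0 = - (xi *m g X Y) 0 0.
Proof.
have := ce_d_eval g xi X Y; rewrite ce_d_covec contr_ce_d1 contr_covec.
by move/(congr1 (fun f : ext F m => f set0)); rewrite !ffunE eqxx !mulr1.
Qed.

(** The Lie derivative of invariant forms, by Cartan's formula. *)
Definition lie_der X a : ext F m := contr X (ce_d g a) + ce_d g (contr X a).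

Lemma lie_derD X a b : lie_der X (a + b) = lie_der X a + lie_der X b.
Proof. by rewrite /lie_der ce_dD !contrD ce_dD addrACA. Qed.

Lemma lie_derZ X x a : lie_der X (x *: a) = x *: lie_der X a.
Proof. by rewrite /lie_der ce_dZ !contrZ ce_dZ scalerDr. Qed.

Lemma lie_der1 X : lie_der X 1 = 0.
Proof. by rewrite /lie_der contr1 ce_d_one !linear0 addr0. Qed.

Lemma lie_der_covecM X xi a :
  lie_der X (covec xi * a) = covec (ad_star g X xi) * a + covec xi * lie_der X a.
Proof.
rewrite /lie_der ce_d_covecM contr_covecM contrB ce_dB ce_dZ.
rewrite contr_ce_d1M contr_covecM ce_d_covecM mulrDr.
rewrite !opprB -!addrA; congr (_ + _); rewrite addKr addrCA; congr (_ + _).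
by rewrite addrCA subrr addr0.
Qed.

(** Both sides are antiderivations of degree -1, so by [ext_ind] they agree as
    soon as they do on covectors, where the claim is the formula
    (d xi)(X, Y) = - xi([X, Y]). *)
Lemma lie_der_contr X Y a :
  lie_der X (contr Y a) - contr Y (lie_der X a) = contr (g X Y) a.
Proof.
elim/(@ext_ind F m): a => [x a b IHa IHb||xi a IH].
- rewrite (contrD Y (x *: a)) (contrZ Y x a) !lie_derD !lie_derZ.
  rewrite (contrD Y (x *: lie_der X a)) (contrZ Y x (lie_der X a)).
  rewrite (contrD (g X Y)) contrZ -IHa -IHb scalerBr.
  by rewrite opprD addrACA.
- by rewrite lie_der1 !contr1 /lie_der !(linear0, addr0).
- rewrite (contr_covecM Y) lie_derD -scaleN1r !lie_derZ !lie_der_covecM.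
  rewrite (contrD Y (covec (ad_star g X xi) * a)) !contr_covecM -IH.
  rewrite ad_star_mul mulrBr scaleN1r scaleNr.
  move: (_ *: lie_der X a) (_ *: a) (_ * contr Y (lie_der _ _)) => P Q T.
  move: (_ * contr Y a) (_ * lie_der X _) => S U.
  by apply/ffunP => Z; rewrite !ffunE; ring.
Qed.

Lemma clifford_gpair X xi a : clifford (gpair X xi) a = contr X a + covec xi * a.
Proof. by rewrite /clifford /gvec /gcov col_mxKu col_mxKd trmxK. Qed.

(** Since [d, X + xi] = L_X + d xi, with d xi acting by a central wedge product,
    the derived bracket of X + xi and Y + eta has the four parts
    [L_X, iota_Y] = iota_[X,Y], [L_X, eta] = L_X eta,
    [d xi, iota_Y] = - iota_Y d xi and [d xi, eta] = 0. *)
Lemma derived_bracket v w a :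
  ce_d g (clifford v (clifford w a)) + clifford v (ce_d g (clifford w a)) -
    clifford w (ce_d g (clifford v a) + clifford v (ce_d g a)) =
  clifford (dorfman g v w) a.
Proof.
have comm_d u b : ce_d g (clifford u b) + clifford u (ce_d g b) =
    lie_der (gvec u) b + ce_d1 g (gcov u) * b.
  rewrite /clifford /lie_der ce_dD ce_d_covecM.
  move: (contr _ (ce_d _ b)) (ce_d g (contr _ _)) (covec _ * _) (_ * b) => P Q S T.
  by apply/ffunP => Z; rewrite !ffunE; ring.
rewrite !comm_d /dorfman clifford_gpair linearB /= mulrBl -lie_der_contr /clifford.
rewrite lie_derD lie_der_covecM !mulrDr.
rewrite (contrD (gvec w) (lie_der (gvec v) a)) contr_ce_d1M.
have := homog2C (covec (gcov w) * a) (@homog_ce_d1 _ _ g (gcov v)).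
rewrite -[in RHS]mulrA (homog2C a (@homog_ce_d1 _ _ g (gcov v))) => ->.
move: (lie_der _ (contr _ _)) (contr _ (lie_der _ _)) => P Q.
move: (_ * contr _ (ce_d _ _)) (_ * ce_d _ _) (_ * contr _ a) => T U V.
move: (_ * (_ * _)) (covec _ * a) (covec _ * a) => x y z.
by apply/ffunP => Z; rewrite !ffunE; ring.
Qed.

Lemma clifford_is_linear v : linear (clifford v).
Proof.
move=> x a b; rewrite /clifford contrD contrZ mulrDr -scalerAr scalerDr.
by rewrite addrACA.
Qed.

HB.instance Definition _ v :=
  GRing.isLinear.Build F (ext F m) (ext F m) *:%R (clifford v)
    (clifford_is_linear v).

Lemma clifford_covecM v xi a :
  clifford v (covec xi * a) = (xi *m gvec v) 0 0 *: a - covec xi * clifford v a.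
Proof.
by rewrite /clifford contr_covecM covec_antiC mulrDr opprD addrA.
Qed.

Lemma clifford_anticomm v w a :
  clifford v (clifford w a) + clifford w (clifford v a) =
  ((gcov v *m gvec w) 0 0 + (gcov w *m gvec v) 0 0) *: a.
Proof.
rewrite /clifford !contrD !contr_covecM (contr_antiC (gvec v)) !mulrDr.
rewrite [covec (gcov v) * (covec _ * a)]covec_antiC scalerDl.
move: (_ *: a) (_ *: a) (contr _ (contr _ _)) (_ * (_ * _)) => P Q R S.
move: (_ * contr _ _) (_ * contr _ _) => T U.
by apply/ffunP => Z; rewrite !ffunE; ring.
Qed.

(** By the derived bracket formula the left-hand side is - w . v . d rho; as v
    anticommutes with u up to a scalar and annihilates rho, v . (u ^ rho) is a
    multiple of rho, which w annihilates. *)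
Lemma dorfman_annihilator v w u (rho : ext F m) : ce_d g rho = covec u * rho ->
    clifford v rho = 0 -> clifford w rho = 0 ->
  clifford (dorfman g v w) rho = 0.
Proof.
move=> drho vr wr; rewrite -derived_bracket vr wr drho clifford_covecM vr.
rewrite mulr0 subr0 !linear0 !add0r linearZ /=.
by rewrite wr scaler0 oppr0.
Qed.

End DerivedBracket.

(** * Exponentials of 2-forms *)

Section Exponential.
Context {F : numFieldType} {m : nat}.
Implicit Types (a b : ext F m) (X : 'cV[F]_m) (xi : 'rV[F]_m).

Lemma ext_expC a b : homog 2 a -> ext_exp a * b = b * ext_exp a.
Proof.
move=> ha; rewrite /ext_exp mulr_suml mulr_sumr; apply: eq_bigr => k _.
rewrite -scalerAl -scalerAr; congr (_ *: _); apply: commr_sym.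
by apply: commrX; rewrite /GRing.comm (homog2C _ ha).
Qed.

(** exp a is 1 plus a nilpotent element commuting with everything, so it can
    be cancelled; this avoids the addition formula for truncated series. *)
Lemma ext_exp_eq0 a b : homog 2 a -> ext_exp a * b = 0 -> b = 0.
Proof.
move=> ha; rewrite /ext_exp big_ord_recl fact0 invr1 scale1r expr0 mulrDl mul1r.
pose M : ext F m := \sum_(k < m) ((bump 0 k)`!)%:R^-1 *: a ^+ k.
rewrite (_ : \sum_(i < m) _ = a * M) => [e|]; last first.
  by rewrite mulr_sumr; apply: eq_bigr => k _; rewrite -scalerAr -exprS.
have {}e : b = a * (- (M * b)) by apply/eqP; rewrite mulrN -addr_eq0 mulrA e.
have [c ->] : exists c, b = a ^+ m.+1 * c.
  elim: m.+1 => [|n [c IH]]; first by exists b; rewrite mul1r.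
  exists (- (M * c)); rewrite {1}e {1}IH exprS -mulrA; congr (_ * _).
  rewrite mulrN !mulrA; congr (- (_ * _)).
  by apply: commrX; rewrite /GRing.comm (homog2C M ha).
by rewrite (homog_gt (homogX (n := m.+1) ha)) ?mul0r// muln2 -addnn ltn_addr.
Qed.

(** A derivation with respect to multiplication by a 2-form a satisfies
    D (exp a) = D a ^ exp a.  The truncation of the series is harmless: the
    missing term D a ^ a^m has degree larger than m.  This is used for the
    contractions and for the differential. *)
Lemma exp_leibniz (D : {linear ext F m -> ext F m}) a b q :
    homog 2 a -> homog q.+1 (D a) ->
    (forall c, D (a * c) = D a * c + a * D c) ->
  D (ext_exp a * b) = ext_exp a * (D a * b + D b).
Proof.
move=> ha hDa Da.
have DX k : D (a ^+ k * b) = k%:R *: (a ^+ k.-1 * (D a * b)) + a ^+ k * D b.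
  elim: k => [|k IH]; first by rewrite scale0r add0r !mul1r.
  rewrite exprS -mulrA Da IH mulrDr addrA; congr (_ + _); last by rewrite mulrA.
  have -> : D a * (a ^+ k * b) = a ^+ k * (D a * b).
    rewrite !mulrA; congr (_ * _); apply: commrX.
    by rewrite /GRing.comm (homog2C (D a) ha).
  rewrite -natr1 scalerDl scale1r addrC; congr (_ + _); rewrite -scalerAr.
  case: k {IH} => [|k]; first by rewrite !scale0r.
  by rewrite (mulrA a) -exprS.
have last0 : a ^+ m * (D a * b) = 0.
  rewrite mulrA (@homog_gt _ _ (m * 2 + q.+1) (a ^+ m * D a)) ?mul0r//.
    by apply: homogM => //; apply: homogX.
  by rewrite addnS ltnS muln2 -addnn -addnA leq_addr.
rewrite mulrDr /ext_exp !mulr_suml linear_sum /=.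
rewrite (eq_bigr (fun k : 'I_m.+1 => (k`!)%:R^-1 *: (k%:R *: (a ^+ k.-1 * (D a * b))) +
   (k`!%:R^-1 *: a ^+ k) * D b)) => [|k _]; last first.
  by rewrite -scalerAl linearZ /= DX scalerDr -scalerAl.
rewrite big_split /=; congr (_ + _).
rewrite big_ord_recl scale0r scaler0 add0r [RHS]big_ord_recr /= -scalerAl last0.
rewrite scaler0 addr0; apply: eq_bigr => k _.
rewrite scalerA -scalerAl; congr (_ *: _).
by rewrite /bump /= add1n factS natrM invfM mulrAC mulVf ?mul1r// pnatr_eq0.
Qed.

Lemma contr_exp X a b : homog 2 a ->
  contr X (ext_exp a * b) = ext_exp a * (contr X a * b + contr X b).
Proof.
move=> ha; apply: (@exp_leibniz (contr X) _ _ 0) => //=.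
  exact: homog_contr ha.
by move=> c; rewrite (contr_antiderivation _ _ ha) sqrrN expr1n scale1r.
Qed.

Lemma ce_d_homog g p a : homog p a -> homog p.+1 (ce_d g a).
Proof.
case: p => [|p] ha.
  rewrite /ce_d big1; first exact: homog0.
  move=> i _; rewrite (_ : contr _ _ = 0) ?mulr0//; apply/ffunP => S.
  by rewrite [RHS]ffunE; apply/eqP/negPn/negP => /(contr_card ha).
rewrite /ce_d; apply: homog_sum => i _.
by apply: (@homogM _ _ 2 p); [exact: homog_ce_d1|exact: homog_contr].
Qed.

Lemma ce_d_exp g a b : homog 2 a ->
  ce_d g (ext_exp a * b) = ext_exp a * (ce_d g a * b + ce_d g b).
Proof.
move=> ha; apply: (@exp_leibniz (ce_d g) _ _ 2) => //=.
  exact: ce_d_homog.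
by move=> c; rewrite (ce_d_leibniz _ _ ha) sqrrN expr1n scale1r.
Qed.

End Exponential.

(** * Decomposable forms and conjugation *)

Section DecomposableForms.
Context {F : fieldType} {m : nat}.
Implicit Types (a b : ext F m) (X : 'cV[F]_m) (xi : 'rV[F]_m).

Lemma contr0l a : contr 0 a = 0.
Proof. by apply/ffunP => S; rewrite !ffunE big1// => i _; rewrite mxE mul0r mulr0. Qed.

Lemma homog_prod_covec k (f : 'I_k -> 'rV[F]_m) :
  homog k (\prod_(j < k) covec (f j)).
Proof.
elim: k f => [|k IH] f; first by rewrite big_ord0; exact: homog1.
by rewrite big_ord_recl; apply: (@homogM _ _ 1 k) => //; exact: homog_covec.
Qed.

Lemma covec_mul_prod k (f : 'I_k -> 'rV[F]_m) i :
  covec (f i) * \prod_(j < k) covec (f j) = 0.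
Proof.
elim: k f i => [|k IH] f i; first by case: i.
rewrite big_ord_recl; case: (unliftP ord0 i) => [j ->|->].
  by rewrite covec_antiC IH mulr0 oppr0.
by rewrite covec_sqM.
Qed.

Lemma covec_span_mul_prod k (f : 'I_k -> 'rV[F]_m) (c : 'I_k -> F) :
  covec (\sum_i c i *: f i) * \prod_(j < k) covec (f j) = 0.
Proof.
rewrite linear_sum mulr_suml big1// => i _.
by rewrite linearZ /= -scalerAl covec_mul_prod scaler0.
Qed.

Lemma contr_prod_covec k (f : 'I_k -> 'rV[F]_m) X :
  (forall i, (f i *m X) 0 0 = 0) -> contr X (\prod_(j < k) covec (f j)) = 0.
Proof.
elim: k f => [|k IH] f fX; first by rewrite big_ord0 contr1.
by rewrite big_ord_recl contr_covecM fX scale0r IH ?mulr0 ?subrr// => i.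
Qed.

(** In a relation with c_0 <> 0 the first factor is a combination of the
    others, and then it kills their product. *)
Lemma prod_covec_free k (f : 'I_k -> 'rV[F]_m) (c : 'I_k -> F) :
    \prod_(j < k) covec (f j) != 0 -> \sum_i c i *: f i = 0 ->
  forall i, c i = 0.
Proof.
elim: k f c => [|k IH] f c; first by move=> _ _ [].
rewrite !big_ord_recl => Om0 sum0.
have c0 : c ord0 = 0.
  apply: contraNeq Om0 => c0; apply/eqP.
  have -> : f ord0 = \sum_(i < k) (- (c ord0)^-1 * c (lift ord0 i)) *: f (lift ord0 i).
    under eq_bigr => i _ do rewrite -scalerA.
    rewrite -scaler_sumr -[in RHS](addKr (c ord0 *: f ord0) (\sum_i _)) sum0.
    by rewrite addr0 scalerN scaleNr opprK scalerA mulVf ?scale1r.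
  exact: (covec_span_mul_prod (fun i => f (lift ord0 i))).
move=> i; case: (unliftP ord0 i) => [j ->|-> //].
apply: (IH (fun i => f (lift ord0 i)) (fun i => c (lift ord0 i))).
  by apply: contraNneq Om0 => ->; rewrite mulr0.
by move: sum0; rewrite c0 scale0r add0r.
Qed.

Lemma prod_covec_row_free k (theta : 'M[F]_(k, m)) :
  \prod_(j < k) covec (row j theta) != 0 -> row_free theta.
Proof.
move=> Om0; apply: inj_row_free => u; rewrite mulmx_sum_row => u0.
by apply/rowP => j; rewrite (prod_covec_free Om0 u0) mxE.
Qed.

(** A nonzero covector dividing both a and b can be cut out of b and moved
    over to a, where it gives zero. *)
Lemma covec_common_factor p xi a b : homog p a -> xi != 0 ->
  covec xi * a = 0 -> covec xi * b = 0 -> a * b = 0.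
Proof.
move=> ha /rV0Pn[i xi0] xa xb; pose Z := (xi 0 i)^-1 *: delta_mx i 0 : 'cV[F]_m.
have xZ : (xi *m Z) 0 0 = 1 by rewrite -scalemxAr -colE !mxE mulVf.
have := contr_covecM Z xi b; rewrite xb linear0 xZ scale1r => /esym/subr0_eq ->.
by rewrite mulrA (wedgeC ha (@homog_covec _ _ xi)) xa scaler0 mul0r.
Qed.

(** A top-degree form N is a multiple of the volume form, and the component of
    the contraction at the complement of i is X_i up to sign and this factor. *)
Lemma contr_top_eq0 (N : ext F m) X : homog m N -> N != 0 -> contr X N = 0 -> X = 0.
Proof.
move=> hN N0 XN; have NT : N setT != 0.
  apply: contraNneq N0 => NT; apply/eqP/ffunP => S; rewrite [RHS]ffunE.
  apply/eqP/negPn/negP => NS; have := hN S NS.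
  rewrite -[in RHS](card_ord m) => cS; have eS : S = setT.
    by apply/eqP; rewrite eqEcard subsetT cardsT cS leqnn.
  by rewrite eS NT eqxx in NS.
apply/colP => i; rewrite [RHS]mxE.
have := congr1 (fun f : ext F m => f (~: [set i])) XN; rewrite !ffunE.
rewrite (big_pred1 i) => [|j]; last by rewrite !inE negbK.
rewrite setUCr => /eqP; rewrite mulf_eq0 signr_eq0 mulf_eq0 (negPf NT) orbF.
by move/eqP.
Qed.

End DecomposableForms.

Section Conjugation.
Context {R : rcfType} {m : nat}.
Local Notation C := R[i].
Implicit Types (a b : ext C m) (X : 'cV[C]_m) (xi : 'rV[C]_m).
Local Notation conj_mx := (map_mx (@Num.conj C)).

Lemma conj_formD a b : conj_form (a + b) = conj_form a + conj_form b.
Proof. by apply/ffunP => S; rewrite !ffunE rmorphD. Qed.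

Lemma conj_formZ x a : conj_form (x *: a) = x^* *: conj_form a.
Proof. by apply/ffunP => S; rewrite !ffunE rmorphM. Qed.

Lemma conj_formM a b : conj_form (a * b) = conj_form a * conj_form b.
Proof.
apply/ffunP => S; rewrite !ffunE rmorph_sum; apply: eq_bigr => T _.
by rewrite !rmorphM rmorph_sign !ffunE.
Qed.

Lemma conj_form0 : conj_form (0 : ext C m) = 0.
Proof. by apply/ffunP => S; rewrite !ffunE rmorph0. Qed.

Lemma conj_form_covec xi : conj_form (covec xi) = covec (conj_mx xi).
Proof.
apply/ffunP => S; rewrite !ffunE rmorph_sum; apply: eq_bigr => i _.
by rewrite mxE.
Qed.

Lemma conj_form_contr X a : conj_form (contr X a) = contr (conj_mx X) (conj_form a).
Proof.
apply/ffunP => S; rewrite !ffunE rmorph_sum; apply: eq_bigr => i _.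
by rewrite !rmorphM rmorph_sign !mxE !ffunE.
Qed.

Lemma homog_conj p a : homog p a -> homog p (conj_form a).
Proof. by move=> ha S; rewrite ffunE conjC_eq0 => /ha. Qed.

End Conjugation.

(** * Real structures from a complex eigenbasis *)

Section StructureFromEigenbasis.
Context {R : rcfType} {m : nat}.
Local Notation C := R[i].
Local Notation conj_mx := (map_mx (@Num.conj C)).
Local Notation toC := (map_mx (real_complex R)).

(** The Gram matrix of twice the pairing. *)
Definition swap_mx (F : fieldType) : 'M[F]_(m + m) := block_mx 0 1%:M 1%:M 0.

Lemma swap_mxK (F : fieldType) : swap_mx F *m swap_mx F = 1%:M.
Proof.
by rewrite mulmx_block !mulmx0 !mul0mx !mulmx1 !addr0 !add0r -scalar_mx_block.
Qed.

Lemma map_swap_mx (F F' : fieldType) (f : {rmorphism F -> F'}) :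
  map_mx f (swap_mx F) = swap_mx F'.
Proof. by rewrite map_block_mx !map_mx1 !map_mx0. Qed.

Lemma pairing_swap (F : fieldType) (v w : 'cV[F]_(m + m)) :
  pairing v w = 2%:R^-1 * (v^T *m swap_mx F *m w) 0 0.
Proof.
rewrite /pairing; congr (_ * _); rewrite -{3}(vsubmxK v) -{3}(vsubmxK w) tr_col_mx.
rewrite mul_row_block !mulmx0 !mulmx1 add0r addr0 mul_row_col [RHS]mxE.
have tr11 (M : 'M[F]_1) : M 0 0 = M^T 0 0 by rewrite [RHS]mxE.
by congr (_ + _); rewrite tr11 trmx_mul trmxK.
Qed.

(** The real structure J whose eigenspace for the imaginary unit is the row
    space of P: in the basis Q of rows of P and of its conjugate, J is the
    diagonal matrix D.  Conjugation exchanges the two halves of Q and of D, so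
    J is real; J is orthogonal because the eigenspaces are isotropic and the
    eigenvalues multiply to 1 across them. *)
Lemma real_structure_of_eigenbasis (P : 'M[C]_(m, m + m)) :
    row_free (col_mx P (conj_mx P)) -> P *m swap_mx C *m P^T = 0 ->
  exists J : 'M[R]_(m + m),
    [/\ J *m J = - 1%:M,
        forall v w, pairing (J *m v) (J *m w) = pairing v w
      & forall v, in_L J v <-> exists u, v = (u *m P)^T].
Proof.
set Q := (col_mx P (conj_mx P))^T.
rewrite row_free_unit -unitmx_tr -/Q => uQ isoP.
have PK : conj_mx (conj_mx P) = P by apply/matrixP => i j; rewrite !mxE conjCK.
have QE : Q = row_mx P^T (conj_mx P)^T by rewrite /Q tr_col_mx.
have Qcol (x y : 'cV_m) : Q *m col_mx x y = P^T *m x + (conj_mx P)^T *m y.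
  by rewrite QE mul_row_col.
have conjQ : conj_mx Q = Q *m swap_mx C.
  rewrite QE map_row_mx mul_row_block !mulmx0 !mulmx1 add0r addr0.
  by rewrite -!map_trmx PK.
have [H [H' QSQ]] : exists H H', Q^T *m swap_mx C *m Q = block_mx 0 H H' 0.
  exists (P *m swap_mx C *m (conj_mx P)^T), (conj_mx P *m swap_mx C *m P^T).
  rewrite {1}/Q trmxK QE mul_col_mx mul_col_row isoP; congr block_mx.
  rewrite -(map_swap_mx (Num.conj : {rmorphism C -> C})) map_trmx -!map_mxM.
  by rewrite isoP map_mx0.
clearbody Q.
pose D : 'M[C]_(m + m) := block_mx 'i%:M 0 0 (- 'i)%:M.
have conjD : swap_mx C *m conj_mx D = D *m swap_mx C.
  rewrite /D map_block_mx !mulmx_block !map_mx0 !map_scalar_mx /= rmorphN /= conjCi.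
  by rewrite !(mul0mx, mulmx0, mulmx1, mul1mx, addr0, add0r) opprK.
have DD : D *m D = - 1%:M.
  rewrite /D mulmx_block !mulmx0 !mul0mx !addr0 !add0r -!scalar_mxM mulrNN -expr2 sqrCi.
  by rewrite !raddfN /= [in RHS]scalar_mx_block opp_block_mx !oppr0.
have DSD : D^T *m block_mx 0 H H' 0 *m D = block_mx 0 H H' 0.
  rewrite /D tr_block_mx !tr_scalar_mx !trmx0 !mulmx_block.
  rewrite !(mul0mx, mulmx0, addr0, add0r) !mul_scalar_mx !mul_mx_scalar !scalerA.
  by rewrite mulrN mulNr -expr2 sqrCi opprK !scale1r.
have Dcol (x y : 'cV_m) : D *m col_mx x y = col_mx ('i *: x) (- 'i *: y).
  by rewrite mul_block_col !mul0mx add0r addr0 !mul_scalar_mx.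
clearbody D.
have [JC JQ] : exists JC, JC *m Q = Q *m D.
  by exists (Q *m D *m invmx Q); rewrite mulmxKV.
have JCJ : conj_mx JC = JC.
  apply: (can_inj (mulmxK uQ)); rewrite JQ.
  have h : conj_mx JC *m Q *m swap_mx C = Q *m D *m swap_mx C.
    rewrite -(mulmxA (conj_mx JC)) -conjQ -map_mxM JQ map_mxM conjQ -[LHS]mulmxA conjD.
    exact: mulmxA.
  by rewrite -[LHS]mulmx1 -(swap_mxK C) mulmxA h -[LHS]mulmxA swap_mxK mulmx1.
have [J JE] : exists J, toC J = JC.
  exists (map_mx (@complex.Re R) JC); apply/matrixP => i j; rewrite 2!mxE.
  have := congr1 (fun M : 'M_(m + m) => M i j) JCJ; rewrite mxE.
  by case: (JC i j) => x y /= -[] /eqP; rewrite eqNr => /eqP ->.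
have toC_inj : injective (fun M : 'M[R]_(m + m) => toC M).
  by move=> M M' /matrixP h; apply/matrixP => i j; have := h i j; rewrite !mxE => -[].
have JJ : JC *m JC = - 1%:M.
  apply: (can_inj (mulmxK uQ)); rewrite -mulmxA JQ mulmxA JQ -mulmxA DD.
  by rewrite mulmxN mulmx1 mulNmx mul1mx.
have orthJ : JC^T *m swap_mx C *m JC = swap_mx C.
  have uQT : Q^T \in unitmx by rewrite unitmx_tr.
  apply: (can_inj (mulmxK uQ)); apply: (can_inj (mulKmx uQT)).
  rewrite -!mulmxA JQ !mulmxA -trmx_mul JQ trmx_mul.
  by rewrite -(mulmxA D^T) -(mulmxA D^T) QSQ.
exists J; split.
- by apply: toC_inj; rewrite map_mxM JE JJ map_mxN map_mx1.
- move=> v w; rewrite !pairing_swap trmx_mul -!mulmxA (mulmxA J^T) (mulmxA (J^T *m _)).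
  rewrite (_ : J^T *m _ *m J = swap_mx R)//; apply: toC_inj.
  by rewrite !map_mxM -map_trmx JE map_swap_mx orthJ.
- move=> v; rewrite /in_L JE; split=> [Jv|[u ->]].
    have [x vQ] : exists x, v = Q *m x by exists (invmx Q *m v); rewrite mulKVmx.
    have Dx : D *m x = 'i *: x.
      apply: (can_inj (mulKmx uQ)).
      by rewrite mulmxA -JQ -mulmxA -vQ Jv vQ scalemxAr.
    exists (usubmx x)^T; rewrite vQ -[in LHS](vsubmxK x) trmx_mul trmxK Qcol.
    suff -> : dsubmx x = 0 by rewrite mulmx0 addr0.
    move/(congr1 dsubmx): Dx; rewrite -{1}(vsubmxK x) Dcol col_mxKd linearZ /= => /eqP.
    rewrite -subr_eq0 scaleNr -opprD oppr_eq0 -scalerDl scaler_eq0 -mulr2n.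
    by rewrite mulrn_eq0 /= (negPf (neq0Ci _)) /= => /eqP.
have -> : (u *m P)^T = Q *m col_mx u^T 0.
  by rewrite Qcol mulmx0 addr0 trmx_mul.
by rewrite mulmxA JQ -mulmxA Dcol scaler0 scalemxAr scale_col_mx scaler0.
Qed.

End StructureFromEigenbasis.

(** * Generalized complex structures from pure spinors *)

Section PureSpinor.
Context {R : rcfType} {m k : nat}.
Local Notation C := R[i].
Local Notation conj_mx := (map_mx (@Num.conj C)).
Variables (omega : ext C m) (theta : 'M[C]_(k, m)).

Let Om : ext C m := \prod_(j < k) covec (row j theta).
Let rho : ext C m := ext_exp ('i *: omega) * Om.

Hypothesis omega_real : real_2form omega.
Hypothesis m_even : ~~ odd m.
Hypothesis k_le : (k <= m./2)%N.
Hypothesis nondeg : omega ^+ (m./2 - k) * Om * conj_form Om != 0.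

Let homega : homog 2 ('i *: omega).
Proof. by apply: homogZ; case: omega_real. Qed.

Let hOm : homog k Om.
Proof. exact: homog_prod_covec. Qed.

Let Om_neq0 : Om != 0.
Proof. by apply: contraNneq nondeg => ->; rewrite mulr0 mul0r. Qed.

Let OmOm_neq0 : Om * conj_form Om != 0.
Proof. by apply: contraNneq nondeg => e; rewrite -mulrA e mulr0. Qed.

Lemma clifford_spinor v :
  clifford v rho = ext_exp ('i *: omega) *
    (contr (gvec v) Om + (covec (gcov v) + 'i *: contr (gvec v) omega) * Om).
Proof.
rewrite /clifford /rho contr_exp// contrZ mulrA -ext_expC// -mulrA -mulrDr.
by rewrite mulrDl addrA addrC addrA.
Qed.

(** After cancelling the exponential, v . rho = 0 splits by degree; this is
    the explicit description of the annihilator. *)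
Lemma clifford_spinor_eq0 v : clifford v rho = 0 ->
  contr (gvec v) Om = 0 /\ (covec (gcov v) + 'i *: contr (gvec v) omega) * Om = 0.
Proof.
rewrite clifford_spinor => /(ext_exp_eq0 homega).
have h1 : homog 1 ('i *: contr (gvec v) omega).
  by rewrite -contrZ; apply: homog_contr.
by rewrite (homog1_covec h1) -linearD /= => /(contr_covec_eq0 hOm).
Qed.

(** For v = X + xi and q = iota_X omega, the hypotheses say that
    iota_X Omega = 0 and (xi + i q) ^ Omega = 0, and after conjugation that
    iota_X conj(Omega) = 0 and (xi - i q) ^ conj(Omega) = 0.  Multiplying by
    the other factor gives q ^ Omega ^ conj(Omega) = 0, so X contracts the
    volume form omega^(n-k) ^ Omega ^ conj(Omega) to zero. *)
Lemma spinor_nondegenerate v :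
  clifford v rho = 0 -> clifford (conj_mx v) rho = 0 -> v = 0.
Proof.
move=> /clifford_spinor_eq0[XOm xOm] /clifford_spinor_eq0[XOm' xOm'].
have [homega2 conj_omega] := omega_real.
have gvecC : conj_mx (gvec (conj_mx v)) = gvec v.
  by apply/matrixP => i j; rewrite !mxE conjCK.
have gcovC : conj_mx (gcov (conj_mx v)) = gcov v.
  by apply/matrixP => i j; rewrite !mxE conjCK.
have {XOm'} XcOm : contr (gvec v) (conj_form Om) = 0.
  by have := congr1 (@conj_form m R) XOm'; rewrite conj_form_contr gvecC conj_form0.
have {xOm'} xcOm : (covec (gcov v) - 'i *: contr (gvec v) omega) * conj_form Om = 0.
  have := congr1 (@conj_form m R) xOm'; rewrite conj_formM conj_formD conj_formZ conjCi.
  by rewrite conj_form_contr conj_form_covec gvecC gcovC conj_form0 conj_omega scaleNr.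
have hq : homog 1 (contr (gvec v) omega) by apply: homog_contr.
have qOm : contr (gvec v) omega * (Om * conj_form Om) = 0.
  move: xOm xcOm; set q := contr _ _ in hq *; set x := covec _.
  rewrite mulrDl mulrBl => /eqP; rewrite addr_eq0 => /eqP xOm /eqP.
  rewrite subr_eq0 => /eqP xcOm.
  have h1 : x * (Om * conj_form Om) = - ('i *: (q * (Om * conj_form Om))).
    by rewrite !mulrA xOm mulNr -!scalerAl.
  have h2 : x * (Om * conj_form Om) = 'i *: (q * (Om * conj_form Om)).
    rewrite mulrA (wedgeC (@homog_covec _ _ _) hOm) -scalerAl -mulrA xcOm.
    rewrite [q * (Om * _)]mulrA (wedgeC hq hOm) -!scalerAl -scalerAr -mulrA.
    by rewrite !scalerA mulrC.
  move/eqP: h1; rewrite h2 -addr_eq0 -mulr2n -scaler_nat scalerA scaler_eq0.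
  by rewrite mulf_eq0 pnatr_eq0 (negPf (neq0Ci _)) => /eqP.
have X0 : gvec v = 0.
  have deg : ((m./2 - k) * 2 + k + k = m)%N.
    rewrite -addnA addnn -muln2 -mulnDl subnK// muln2.
    by rewrite -[RHS]odd_double_half (negPf m_even).
  have hN : homog m (omega ^+ (m./2 - k) * Om * conj_form Om).
    have := homogM (homogM (homogX (n := m./2 - k) homega2) hOm) (homog_conj hOm).
    by rewrite deg.
  apply: contr_top_eq0 hN nondeg _.
  rewrite -mulrA; elim: (_ - _)%N => [|n IH].
    by rewrite mul1r (contr_antiderivation _ _ hOm) XOm XcOm mul0r mulr0 scaler0 addr0.
  rewrite exprS -mulrA (contr_antiderivation _ _ homega2) IH mulr0 scaler0 addr0.
  rewrite mulrA [_ * omega ^+ n](_ : _ = omega ^+ n * contr (gvec v) omega).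
    by rewrite -mulrA qOm mulr0.
  by apply: commrX; rewrite /GRing.comm (homog2C _ homega2).
have x0 : gcov v = 0.
  move: xOm xcOm; rewrite X0 contr0l scaler0 addr0 subr0 => xOm xcOm.
  apply: contraNeq OmOm_neq0 => x0; apply/eqP.
  exact: covec_common_factor hOm x0 xOm xcOm.
by rewrite -[v]vsubmxK -/(gvec v) X0 -[dsubmx v]trmxK -/(gcov v) x0 trmx0 col_mx0.
Qed.

(** A real covector annihilating rho would lie in L and in its conjugate. *)
Lemma covec_spinor_neq0 xi : xi != 0 -> conj_mx xi = xi -> covec xi * rho != 0.
Proof.
move=> xi0 xiR; apply: contra_neq xi0 => xr.
have conj0 : conj_mx (gpair 0 xi) = gpair 0 xi.
  by rewrite /gpair map_col_mx map_mx0 -map_trmx xiR.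
have : gpair 0 xi = 0.
  apply: spinor_nondegenerate; rewrite ?conj0 clifford_gpair contr0l xr addr0//.
by move/(congr1 dsubmx); rewrite col_mxKd linear0 => /(congr1 trmx); rewrite trmxK trmx0.
Qed.

(** The matrix of the map from vectors to covectors given by a 2-form. *)
Lemma contr_mx (a : ext C m) : homog 2 a ->
  exists W : 'M[C]_m, forall X, contr X a = covec (X^T *m W).
Proof.
move=> ha; exists (\matrix_(i, j) contr (delta_mx i 0) a [set j]) => X.
rewrite [X in contr X a](matrix_sum_delta X) mulmx_sum_row linear_sum /=.
elim/big_ind2: _ => [|x1 X1 x2 X2 <- <-|i _].
- exact: contr0l.
- by have := contr_linearl a 1 X1 X2; rewrite !scale1r.
rewrite big_ord1 linearZ /= mxE; have := contr_linearl a (X i 0) (delta_mx i 0) 0.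
rewrite /= addr0 contr0l addr0 => ->; congr (_ *: _).
rewrite [LHS](homog1_covec (homog_contr ha)); congr covec.
by apply/rowP => j; rewrite !mxE.
Qed.

Lemma cliffordB v w (a : ext C m) : clifford (v - w) a = clifford v a - clifford w a.
Proof.
rewrite /clifford /gvec /gcov !linearB /= mulrBl.
have := contr_linearl a (-1) (usubmx w) (usubmx v).
by rewrite /= !scaleN1r ![- _ + _]addrC => ->; rewrite opprD addrACA.
Qed.

(** Let E_0, ..., E_(m-1) be a basis of covectors whose first k elements span
    the factors of Omega, and X_j the dual basis of vectors.  The covectors E_j
    for j < k and the elements X_j - i iota_(X_j) omega for j >= k annihilate
    rho; they are the rows of P, [pid_mx] and [copid_mx] selecting the two
    ranges of j. *)
Lemma spinor_eigenbasis : exists P : 'M[C]_(m, m + m),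
  row_free P /\ forall u, clifford (u *m P)^T rho = 0.
Proof.
have [W hW] := contr_mx (proj1 omega_real).
have rk : \rank theta = k by apply/eqP; exact: prod_covec_row_free.
pose E := row_ebase theta; have uE : E \in unitmx := row_ebase_unit theta.
have thetaE : theta = col_ebase theta *m pid_mx k *m E.
  by rewrite -{1}(mulmx_ebase theta) rk.
have km : (k <= m)%N by rewrite -rk rank_leq_col.
pose A := copid_mx k *m (invmx E)^T : 'M[C]_m.
pose B := pid_mx k *m E - 'i *: (A *m W) : 'M[C]_m.
exists (row_mx A B); split=> [|u].
  apply: inj_row_free => u; rewrite mul_mx_row -[RHS]row_mx0 => /eq_row_mx[].
  have uET : (invmx E)^T \in unitmx by rewrite unitmx_tr unitmx_inv.
  rewrite /B mulmxBr -scalemxAr (mulmxA u A) => uA; rewrite uA mul0mx scaler0 subr0.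
  move=> /(congr1 (mulmx^~ (invmx E))); rewrite mulmxA mulmxK// mul0mx => upid.
  move/(congr1 (mulmx^~ (invmx (invmx E)^T))): uA.
  rewrite /A mulmxA mulmxK// mul0mx /copid_mx mulmxBr mulmx1 upid subr0 => ->.
  by [].
rewrite clifford_spinor mul_mx_row tr_row_mx /gvec /gcov col_mxKu col_mxKd trmxK.
set X := (u *m A)^T.
have -> : contr X Om = 0.
  apply: contr_prod_covec => j; rewrite -row_mul.
  suff -> : theta *m X = 0 by rewrite row0 mxE.
  rewrite thetaE /X /A mulmxA !trmx_mul trmxK -!mulmxA (mulmxA E) mulmxV// mul1mx.
  rewrite (mulmxA (pid_mx k)) /copid_mx linearB /= trmx1 tr_pid_mx mulmxBr mulmx1.
  by rewrite mul_pid_mx minnn (minn_idPr km) subrr mul0mx mulmx0.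
rewrite add0r hW trmxK -linearZ /= -linearD /= {1}/B mulmxBr -scalemxAr (mulmxA u A).
rewrite subrK mulmxA.
have -> : u *m pid_mx k *m E =
    \sum_i (u *m (pid_mx k *m invmx (col_ebase theta))) 0 i *: row i theta.
  rewrite -mulmx_sum_row {2}thetaE !mulmxA mulmxKV ?col_ebase_unit//.
  by rewrite -[u *m _ *m pid_mx k]mulmxA mul_pid_mx minnn (minn_idPr (leqnn k)).
by rewrite covec_span_mul_prod mulr0.
Qed.

Theorem pure_spinor_defines_gcs (g : lieAlgebra R m) u :
  ce_d (complexify g) rho = covec u * rho -> defines_gcs g k rho.
Proof.
move=> drho; have [P [freeP annP]] := spinor_eigenbasis.
have rho_neq0 : rho != 0.
  by apply: contraNneq Om_neq0 => /(ext_exp_eq0 homega) ->.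
have conjK (n p : nat) (M : 'M[C]_(n, p)) : conj_mx (conj_mx M) = M.
  by apply/matrixP => i j; rewrite !mxE conjCK.
have PPfree : row_free (col_mx P (conj_mx P)).
  apply: inj_row_free => w; rewrite -(hsubmxK w) mul_row_col.
  move=> /eqP; rewrite addr_eq0 => /eqP e.
  have v0 : (lsubmx w *m P)^T = 0.
    apply: spinor_nondegenerate; first exact: annP.
    rewrite e -mulNmx -map_trmx map_mxM conjK; exact: annP.
  have e1 : lsubmx w *m P = 0 by rewrite -[LHS]trmxK v0 trmx0.
  have e2 : conj_mx (rsubmx w) *m P = 0.
    rewrite -[LHS]conjK map_mxM conjK -[_ *m _]opprK -e e1 oppr0 map_mx0//.
  have w1 : lsubmx w = 0 by apply: (row_free_inj freeP); rewrite e1 mul0mx.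
  have w2 : conj_mx (rsubmx w) = 0 by apply: (row_free_inj freeP); rewrite e2 mul0mx.
  by rewrite w1 -[rsubmx w]conjK w2 map_mx0 row_mx0.
have iso : P *m swap_mx C *m P^T = 0.
  have pairP u1 u2 : pairing (u1 *m P)^T (u2 *m P)^T = 0.
    have := clifford_anticomm (u1 *m P)^T (u2 *m P)^T rho.
    rewrite !annP !linear0 addr0 => /esym/eqP.
    by rewrite scaler_eq0 (negPf rho_neq0) orbF /pairing => /eqP ->; rewrite mulr0.
  apply/matrixP => i j; rewrite [RHS]mxE.
  have := pairP (delta_mx 0 i) (delta_mx 0 j).
  rewrite pairing_swap trmxK trmx_mul trmx_delta !mulmxA -colE -!mulmxA -rowE !mulmxA.
  move/eqP; rewrite mulf_eq0 invr_eq0 pnatr_eq0 /= 2!mxE => /eqP.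
  by [].
have [J [JJ orthJ inJ]] := real_structure_of_eigenbasis PPfree iso.
(* L is no larger than the row space of P: the component of v along the
   conjugate of that row space lies in L and so does its conjugate. *)
have LE v : clifford v rho = 0 <-> in_L J v.
  split=> [vr|/inJ[w ->]]; last exact: annP.
  have uP : col_mx P (conj_mx P) \in unitmx by rewrite -row_free_unit.
  have [w vw] : exists w, v^T = w *m col_mx P (conj_mx P).
    by exists (v^T *m invmx (col_mx P (conj_mx P))); rewrite mulmxKV.
  move: vw; rewrite -(hsubmxK w) mul_row_col => vw.
  have z0 : (rsubmx w *m conj_mx P)^T = 0.
    apply: spinor_nondegenerate; last by rewrite -map_trmx map_mxM conjK; exact: annP.
    have -> : (rsubmx w *m conj_mx P)^T = v - (lsubmx w *m P)^T.
      by rewrite -[v]trmxK vw [in RHS]linearD /= addrC addKr.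
    by rewrite cliffordB vr annP subrr.
  apply/inJ; exists (lsubmx w); rewrite -[v]trmxK vw.
  by rewrite [LHS]linearD /= z0 addr0.
exists J; split; first split=> //.
- by move=> v w /LE vr /LE wr; apply/LE; apply: dorfman_annihilator drho vr wr.
- by split.
- exists 0, omega, 1, theta; rewrite /= !scale1r add0r; split=> //.
  split=> //; [|exact: oner_neq0|exact: prod_covec_row_free].
  by split; [exact: homog0|exact: conj_form0].
Qed.

End PureSpinor.

(** * Symbolic computation with invariant forms *)

Section SymbolicForms.
Context {R : rcfType}.
Local Notation C := R[i].
Local Notation mform := (seq (C * seq nat)).
Implicit Types (P Q : mform) (s t : seq nat).

(** The basis covector e^n, extended by zero so that the index can be a natural
    number on which symbolic computations reduce. *)
Definition gen (n : nat) : ext C 6 := if Nat.ltb n 6 then e n%:R else 0.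

Definition mono s : ext C 6 := foldr (fun i a => gen i * a) 1 s.

(** Forms are encoded by lists of terms, in which a monomial may be repeated:
    products and differentials are then mere expansions, and terms are merged
    only once, by [collect]. *)
Fixpoint den P : ext C 6 :=
  if P is (c, s) :: P' then c *: mono s + den P' else 0.

(** The product of e^i with a sorted monomial: a sign and a sorted monomial, or
    [None] if e^i already occurs.  The comparison is structurally recursive, so
    that it reduces on numerals. *)
Fixpoint insert (i : nat) s : option (bool * seq nat) :=
  if s is j :: s' then
    match Nat.compare i j with
    | Eq => None
    | Lt => Some (false, i :: s)
    | Gt => if insert i s' is Some (b, t) then Some (negb b, j :: t) else None
    end
  else Some (false, [:: i]).

Fixpoint mono_mul s t : option (bool * seq nat) :=
  if s is i :: s' then
    if mono_mul s' t is Some (b, u) then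
      if insert i u is Some (b', u') then Some (xorb b b', u') else None
    else None
  else Some (false, t).

Fixpoint term_mul (c : C) s P : mform :=
  if P is (c', s') :: P' then
    match mono_mul s s' with
    | None => term_mul c s P'
    | Some (b, t) => ((if b then - (c * c') else c * c'), t) :: term_mul c s P'
    end
  else [::].

Fixpoint form_mul P Q : mform :=
  if P is (c, s) :: P' then term_mul c s Q ++ form_mul P' Q else [::].

Fixpoint form_scale (c : C) P : mform :=
  if P is (c', s) :: P' then (c * c', s) :: form_scale c P' else [::].

Fixpoint form_conj P : mform :=
  if P is (c, s) :: P' then (c^*, s) :: form_conj P' else [::].

Fixpoint mono_eqb s t : bool :=
  match s, t with
  | [::], [::] => true
  | i :: s', j :: t' => if Nat.eqb i j then mono_eqb s' t' else false
  | _, _ => false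
  end.

Fixpoint add_term (c : C) s P : mform :=
  if P is (c', s') :: P' then
    if mono_eqb s s' then (c' + c, s') :: P' else (c', s') :: add_term c s P'
  else [:: (c, s)].

(** Gathering the coefficients of each monomial; a form vanishes as soon as all
    of them do. *)
Fixpoint collect P : mform :=
  if P is (c, s) :: P' then add_term c s (collect P') else [::].

Fixpoint null_coefs P : Prop :=
  if P is (c, s) :: P' then c = 0 /\ null_coefs P' else True.

Fixpoint of_degree (p : nat) P : bool :=
  if P is (c, s) :: P' then
    if Nat.eqb (size s) p then of_degree p P' else false
  else true.

Lemma compare_Eq i j : Nat.compare i j = Eq -> i = j.
Proof. by elim: i j => [|i IH] [|j] //= /IH ->. Qed.

Lemma eqb_eq i j : Nat.eqb i j = (i == j).
Proof. by elim: i j => [|i IH] [|j] //=; rewrite IH eqSS. Qed.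

Lemma ltb_lt i j : Nat.ltb i j = (i < j)%N.
Proof.
have leb_le k l : Nat.leb k l = (k <= l)%N by elim: k l => [|k IH] [|l] //=; rewrite IH.
exact: leb_le.
Qed.

Lemma sub_subn i j : Nat.sub i j = (i - j)%N.
Proof. by []. Qed.

Lemma gen_covec i : exists xi, gen i = covec xi.
Proof.
rewrite /gen; case: Nat.ltb; first by exists (delta_mx 0 i%:R).
by exists 0; rewrite linear0.
Qed.

Lemma insertP i s :
  gen i * mono s = if insert i s is Some (b, t) then (-1) ^+ b *: mono t else 0.
Proof.
have [xi gi] := gen_covec i.
elim: s => [|j s IH] /=; first by rewrite scale1r.
have [eta gj] := gen_covec j.
case ij: (Nat.compare i j) => /=.
- by rewrite -(compare_Eq ij) gi covec_sqM.
- by rewrite scale1r.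
rewrite gi gj covec_antiC -gi -gj IH.
case: (insert i s) => [[b t]|]; last by rewrite mulr0 oppr0.
by rewrite -scalerAr -scaleNr; case: b => /=; rewrite ?opprK.
Qed.

Lemma mono_mulP s t :
  mono s * mono t = if mono_mul s t is Some (b, u) then (-1) ^+ b *: mono u else 0.
Proof.
elim: s => [|i s IH] /=; first by rewrite mul1r scale1r.
rewrite -mulrA IH; case: (mono_mul s t) => [[b u]|]; last by rewrite mulr0.
rewrite -scalerAr insertP; case: (insert i u) => [[b' u']|]; last by rewrite scaler0.
by rewrite scalerA; case: b b' => -[]; rewrite /= ?expr1 ?mulrNN ?mul1r ?mulr1.
Qed.

Lemma den_cat P Q : den (P ++ Q) = den P + den Q.
Proof. by elim: P => [|[c s] P IH] /=; rewrite ?add0r// IH addrA. Qed.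

Lemma den_term_mul c s P : den (term_mul c s P) = c *: mono s * den P.
Proof.
elim: P => [|[c' s'] P IH] /=; first by rewrite mulr0.
rewrite mulrDr -IH -scalerAl -scalerAr mono_mulP scalerA.
case: (mono_mul s s') => [[b t]|] /=; last by rewrite scaler0 add0r.
by congr (_ + _); case: b; rewrite scalerA ?mulrN1 ?mulr1.
Qed.

Lemma den_mul P Q : den (form_mul P Q) = den P * den Q.
Proof.
elim: P => [|[c s] P IH] /=; first by rewrite mul0r.
by rewrite den_cat den_term_mul IH mulrDl.
Qed.

Lemma den_scale c P : den (form_scale c P) = c *: den P.
Proof.
elim: P => [|[c' s] P IH] /=; first by rewrite scaler0.
by rewrite IH scalerDr scalerA.
Qed.

Lemma conj_gen i : conj_form (gen i) = gen i.
Proof.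
rewrite /gen; case: Nat.ltb; last exact: conj_form0.
rewrite /e conj_form_covec; congr covec; apply/rowP => j.
by rewrite !mxE; case: (_ && _); rewrite ?rmorph1 ?rmorph0.
Qed.

Lemma conj_mono s : conj_form (mono s) = mono s.
Proof.
elim: s => [|i s IH] /=; last by rewrite conj_formM IH conj_gen.
by apply/ffunP => S; rewrite !ffunE; case: (S == set0); rewrite ?rmorph1 ?rmorph0.
Qed.

Lemma den_conj P : den (form_conj P) = conj_form (den P).
Proof.
elim: P => [|[c s] P IH] /=; first by rewrite conj_form0.
by rewrite IH conj_formD conj_formZ conj_mono.
Qed.

Lemma mono_eqbP s t : mono_eqb s t -> s = t.
Proof.
elim: s t => [|i s IH] [|j t] //=.
by rewrite eqb_eq; case: eqP => // -> /IH ->.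
Qed.

Lemma den_add_term c s P : den (add_term c s P) = c *: mono s + den P.
Proof.
elim: P => [|[c' s'] P IH] //=; case: ifP => [/mono_eqbP ->|_] /=.
  by rewrite scalerDl addrA [_ *: _ + _ *: _]addrC.
by rewrite IH addrCA.
Qed.

Lemma den_collect P : den (collect P) = den P.
Proof. by elim: P => [|[c s] P IH] //=; rewrite den_add_term IH. Qed.

Lemma den_eq0 P : null_coefs (collect P) -> den P = 0.
Proof.
rewrite -den_collect; elim: (collect P) => [|[c s] Q IH] //= [-> /IH ->].
by rewrite scale0r addr0.
Qed.

Lemma homog_mono s : homog (size s) (mono s).
Proof.
elim: s => [|i s IH] /=; first exact: homog1.
by have [xi ->] := gen_covec i; apply: (@homogM _ _ 1) => //; exact: homog_covec.
Qed.

Lemma homog_den p P : of_degree p P -> homog p (den P).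
Proof.
elim: P => [|[c s] P IH] /=; first by move=> _; exact: homog0.
rewrite eqb_eq; case: eqP => // sp h; apply: homogD (IH h).
by apply: homogZ; rewrite -sp; exact: homog_mono.
Qed.

Lemma contr_gen i j : (i < 6)%N -> (j < 6)%N ->
  contr (delta_mx i%:R 0) (gen j) = (i == j)%:R.
Proof.
move=> i6 j6; rewrite /gen ltb_lt j6 /e contr_covec -rowE !mxE eqxx andbT.
have -> : ((j%:R : 'I_6) == i%:R) = (i == j).
  by rewrite -(inj_eq val_inj) /= !Zp_nat /= !modn_small// eq_sym.
by case: (i == j); rewrite ?scale1r ?scale0r.
Qed.

Lemma contr_genM i j a : (i < 6)%N -> (j < 6)%N ->
  contr (delta_mx i%:R 0) (gen j * a) =
  (i == j)%:R * a - gen j * contr (delta_mx i%:R 0) a.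
Proof.
move=> i6 j6; rewrite -contr_gen//; have [xi ->] := gen_covec j.
by rewrite contr_covecM contr_covec -scalerAl mul1r.
Qed.

(** Contracting with the dual basis vectors removes the factors one by one,
    down to 1. *)
Lemma mono_neq0 s : uniq s -> all (fun i => i < 6)%N s -> mono s != 0.
Proof.
have contr_mono i t : i \notin t -> (i < 6)%N -> all (fun j => j < 6)%N t ->
    contr (delta_mx i%:R 0) (mono t) = 0.
  move=> + i6; elim: t => [_ _|j t IH] /=; first exact: contr1.
  rewrite inE => /norP[/negPf ij it] /andP[j6 t6].
  by rewrite contr_genM// ij IH// mulr0 mul0r subrr.
elim: s => [|i s IH] /=; first by move=> _ _; exact: oner_neq0.
move=> /andP[is_ us] /andP[i6 s6]; apply: contra_neq (IH us s6) => is0.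
have := contr_genM (mono s) i6 i6.
by rewrite is0 linear0 eqxx mul1r contr_mono// mulr0 subr0.
Qed.

Section Differential.
Variables (A : 'M[R]_5) (f : nat -> nat -> option R).

(** The entries of a matrix as a function on natural numbers, which reduces on
    numerals; [None] is a structural zero, and contributes no term to the
    differentials computed from it. *)
Definition represents (n : nat) (B : 'M[R]_n) (h : nat -> nat -> option R) :=
  forall i j : 'I_n, B i j = odflt 0 (h i j).

Hypothesis Af : represents A f.
Local Notation d := (ce_d (complexify (semidirect A))).

Fixpoint row_terms (r : nat -> option R) (js : seq nat) : mform :=
  if js is j :: js' then
    if r j is Some c then (- c%:C%C, [:: 0%N; S j]) :: row_terms r js'
    else row_terms r js'
  else [::].

Definition form_d1 (i : nat) : mform :=
  if i is S p then
    if Nat.ltb p 5 then row_terms (f p) [:: 0; 1; 2; 3; 4]%N else [::]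
  else [::].

Fixpoint mono_d s : mform :=
  if s is i :: s' then
    form_mul (form_d1 i) [:: (1, s')] ++
    form_scale (-1) (form_mul [:: (1, [:: i])] (mono_d s'))
  else [::].

Fixpoint form_d P : mform :=
  if P is (c, s) :: P' then form_scale c (mono_d s) ++ form_d P' else [::].

Lemma gen_rshift (p : 'I_5) : gen p.+1 = e (rshift 1 p).
Proof.
rewrite /gen ltb_lt ltnS ltn_ord; congr e; apply: val_inj => /=.
by rewrite Zp_nat /= modn_small ?add1n// ltnS ltn_ord.
Qed.

Lemma den_row_terms r js :
  den (row_terms r js) = - (e 0 * \sum_(j <- js) (odflt 0 (r j))%:C%C *: gen j.+1).
Proof.
elim: js => [|j js IH] /=; first by rewrite big_nil mulr0 oppr0.
rewrite big_cons mulrDr opprD -IH; case: (r j) => [c|] /=.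
  by rewrite mulr1 -scalerAr scaleNr.
by rewrite rmorph0 scale0r mulr0 oppr0 add0r.
Qed.

Lemma den_d1 i : den (form_d1 i) = d (gen i).
Proof.
case: i => [|p]; first exact/esym/ce_d_semidirect0.
rewrite /form_d1 ltb_lt; case: ltnP => p5; last first.
  by rewrite /gen ltb_lt ltnS ltnNge p5 /= linear0.
rewrite -[p]/(val (Ordinal p5)) gen_rshift ce_d_semidirectS den_row_terms.
congr (- (_ * _)).
rewrite (_ : [:: _; _; _; _; _] = [seq val i | i <- enum 'I_5]); last first.
  by rewrite val_enum_ord.
rewrite big_map big_enum /=; apply: eq_bigr => j _.
by rewrite Af gen_rshift.
Qed.

Lemma den_mono_d s : den (mono_d s) = d (mono s).
Proof.
elim: s => [|i s IH] /=; first by rewrite ce_d_one.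
rewrite den_cat den_scale den_mul (den_mul [:: (1, [:: i])]) /=.
rewrite !addr0 !scale1r mulr1 IH den_d1.
have [xi gi] := gen_covec i.
by rewrite scaleN1r gi ce_d_covecM ce_d_covec.
Qed.

Lemma den_d P : den (form_d P) = d (den P).
Proof.
elim: P => [|[c s] P IH] /=; first by rewrite linear0.
by rewrite den_cat den_scale IH den_mono_d ce_dD ce_dZ.
Qed.

End Differential.
End SymbolicForms.

(** * Reduction of a row of the table to coefficient identities *)

Section RowCheck.
Context {R : rcfType}.
Local Notation C := R[i].
Local Notation mform := (seq (C * seq nat)).

Definition form1 : mform := [:: (1, [::])].

Fixpoint form_exp (P : mform) (n : nat) : mform :=
  if n is S n' then form_mul P (form_exp P n') else form1.

Fixpoint form_prod (Ps : seq mform) : mform :=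
  if Ps is P :: Ps' then form_mul P (form_prod Ps') else form1.

Lemma den_form1 : den form1 = 1.
Proof. by rewrite /= scale1r addr0. Qed.

Lemma den_exp P n : den (form_exp P n) = den P ^+ n.
Proof.
elim: n => [|n IH]; first exact: den_form1.
by rewrite [form_exp _ _]/= den_mul IH exprS.
Qed.

Lemma den_prod Ps : den (form_prod Ps) = \prod_(P <- Ps) den P.
Proof.
elim: Ps => [|P Ps IH]; first by rewrite big_nil; exact: den_form1.
by rewrite big_cons [form_prod _]/= den_mul IH.
Qed.

Definition degrees_ok (Ps : seq mform) (Pw : mform) : bool :=
  [&& all (of_degree 1) Ps, of_degree 2 Pw & (size Ps <= 3)%N].

(** In order: omega is real; d omega ^ Omega = 0; d Omega = - Lambda e^0 ^ Omega;
    omega^(3-k) ^ Omega ^ conj(Omega) = c e^012345.  Each is stated for the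
    difference of its two sides, coefficient by coefficient; Omega is the
    product of the one-forms Ps. *)
Definition row_identities (f : nat -> nat -> option R) (Ps : seq mform)
    (Pw : mform) (Lambda c : C) : Prop :=
  let PO := form_prod Ps in
  [/\ null_coefs (collect (form_conj Pw ++ form_scale (-1) Pw)),
      null_coefs (collect (form_mul (form_d f Pw) PO)),
      null_coefs (collect (form_d f PO ++
        form_scale Lambda (form_mul [:: (1, [:: 0%N])] PO)))
    & null_coefs (collect
        (form_mul (form_mul (form_exp Pw (Nat.sub 3 (size Ps))) PO) (form_conj PO) ++
         [:: (- c, [:: 0; 1; 2; 3; 4; 5]%N)]))].

(** From the identities, d rho = exp(i omega) ^ (i d omega ^ Omega + d Omega)
    is - Lambda e^0 ^ rho, so [pure_spinor_defines_gcs] applies with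
    u = - Lambda e^0. *)
Lemma row_claim_of_identities (A : 'M[R]_5) f (Ps : seq mform) (Pw : mform)
    (Omega omega : ext C 6) (Lambda c : C) :
    represents A f ->
    Omega = \prod_(P <- Ps) den P -> omega = den Pw ->
    degrees_ok Ps Pw -> row_identities f Ps Pw Lambda c ->
  c != 0 -> row_claim A (size Ps) Omega omega Lambda c.
Proof.
move=> Af eOm eom /and3P[deg1 deg2 k3] [real_om dom_Om dOm vol] c0.
pose theta : 'M[C]_(size Ps, 6) := \matrix_(j, i) den (nth [::] Ps j) [set i].
have OmE : Omega = \prod_(j < size Ps) covec (row j theta).
  rewrite eOm (big_nth [::]) big_mkord; apply: eq_bigr => j _.
  rewrite [LHS]homog1_covec; last by apply: homog_den; apply: (allP deg1); rewrite mem_nth.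
  by congr covec; apply/rowP => i; rewrite !mxE.
have PsE : den (form_prod Ps) = Omega by rewrite den_prod eOm.
have omR : real_2form omega.
  split; first by rewrite eom; apply: homog_den.
  move/den_eq0: real_om; rewrite den_cat den_scale den_conj scaleN1r -eom.
  by move/eqP; rewrite subr_eq0 => /eqP.
have volE : omega ^+ (3 - size Ps) * Omega * conj_form Omega =
    c *: (e 0 * e 1 * e 2 * e 3 * e 4 * e 5).
  move/den_eq0: vol; rewrite den_cat !den_mul den_conj den_exp PsE -eom.
  rewrite [den [:: _]]/= addr0 scaleNr => /eqP; rewrite subr_eq0 => /eqP ->.
  by congr (_ *: _); rewrite /mono /= mulr1 !mulrA.
have nondeg : omega ^+ (6./2 - size Ps) * Omega * conj_form Omega != 0.
  rewrite [X in X != 0]volE scaler_eq0 (negPf c0) /=.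
  have := @mono_neq0 R [:: 0; 1; 2; 3; 4; 5]%N isT isT.
  by rewrite /mono /= mulr1 !mulrA.
have drho : ce_d (complexify (semidirect A)) (ext_exp ('i *: omega) * Omega) =
    - Lambda *: (e 0 * (ext_exp ('i *: omega) * Omega)).
  have h2 : homog 2 ('i *: omega) by apply: homogZ; case: omR.
  move/den_eq0: dom_Om; rewrite den_mul (den_d Af) PsE -eom => dom_Om.
  move/den_eq0: dOm; rewrite den_cat den_scale den_mul (den_d Af) PsE.
  rewrite [den [:: _]]/= scale1r addr0 mulr1 => /eqP; rewrite addr_eq0 => /eqP dOm.
  rewrite (ce_d_exp _ _ h2) ce_dZ -scalerAl dom_Om scaler0 add0r dOm.
  rewrite mulrN -scalerAr scaleNr mulrA (ext_expC _ h2) -mulrA.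
  by [].
rewrite OmE in nondeg drho *.
split=> //; last split=> [d0|L0].
- apply: (pure_spinor_defines_gcs omR _ _ nondeg (u := - Lambda *: delta_mx 0 0)) => //.
  by rewrite drho linearZ /= -scalerAl.
- by rewrite -OmE.
- have e0_neq0 : (delta_mx 0 0 : 'rV[C]_6) != 0.
    by apply/eqP => /matrixP/(_ 0 0)/eqP; rewrite !mxE oner_eq0.
  have e0_real : map_mx Num.conj (delta_mx 0 0) = delta_mx 0 0 :> 'rV[C]_6.
    by rewrite map_delta_mx.
  have := covec_spinor_neq0 omR isT k3 nondeg e0_neq0 e0_real.
  move: drho; rewrite d0 => /esym/eqP; rewrite scaler_eq0 oppr_eq0.
  by case/orP => [/eqP //|/eqP ->]; rewrite eqxx.
- by rewrite drho L0 oppr0 scale0r.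
Qed.

Lemma row_claim1 (A : 'M[R]_5) f P Pw (Omega omega : ext C 6) Lambda c :
    represents A f -> Omega = den P -> omega = den Pw ->
    degrees_ok [:: P] Pw -> row_identities f [:: P] Pw Lambda c ->
  c != 0 -> row_claim A 1 Omega omega Lambda c.
Proof.
by move=> Af eOm; apply: row_claim_of_identities Af _; rewrite big_seq1.
Qed.

Lemma row_claim2 (A : 'M[R]_5) f P Q Pw (a b omega : ext C 6) Lambda c :
    represents A f -> a = den P -> b = den Q -> omega = den Pw ->
    degrees_ok [:: P; Q] Pw -> row_identities f [:: P; Q] Pw Lambda c ->
  c != 0 -> row_claim A 2 (a * b) omega Lambda c.
Proof.
move=> Af -> ->; apply: row_claim_of_identities Af _.
by rewrite big_cons big_seq1.
Qed.

Section Representations.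
Implicit Types (f g : nat -> nat -> option R).

Definition block_entries (m : nat) f g (i j : nat) : option R :=
  if Nat.ltb i m then if Nat.ltb j m then f i j else None
  else if Nat.ltb j m then None else g (Nat.sub i m) (Nat.sub j m).

Lemma represents_block m n (B : 'M[R]_m) (B' : 'M[R]_n) f g :
  represents B f -> represents B' g ->
  represents (B \oplus B') (block_entries m f g).
Proof.
move=> Bf Bg i j; rewrite /block_entries !ltb_lt !sub_subn.
case: (split_ordP i) => i' ->; case: (split_ordP j) => j' -> /=.
- by rewrite block_mxEul Bf.
- by rewrite block_mxEur mxE.
- by rewrite block_mxEdl mxE.
- by rewrite block_mxEdr !addKn Bg.
Qed.

Definition jordan_entries (t : R) (i j : nat) : option R :=
  if Nat.eqb i j then Some t else if Nat.eqb (S i) j then Some 1 else None.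

Lemma represents_jordan r t : represents (jordan_block r t) (jordan_entries t).
Proof.
move=> i j; rewrite mxE /jordan_entries !eqb_eq -(inj_eq val_inj) /=.
case: (eqVneq (val i) (val j)) => [->|_] /=; first by rewrite gtn_eqF ?addr0.
by rewrite add0r; case: (_ == _).
Qed.

Definition scalar_entries (t : R) (i j : nat) : option R := Some t.

Lemma represents_scalar t : represents (scalar_block t) (scalar_entries t).
Proof. by move=> i j; rewrite !ord1 mxE eqxx. Qed.

Definition rot_entries (a b : R) (i j : nat) : option R :=
  Some (match i, j with
        | O, O => a | O, S _ => - b | S _, O => b | S _, S _ => a end).

Lemma represents_rot a b : represents (rot_block a b) (rot_entries a b).
Proof.
move=> i j.
case: (@split_ordP 1 1 i) => i' ->; case: (@split_ordP 1 1 j) => j' -> /=; rewrite !ord1.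
- by rewrite (@block_mxEul _ 1 1 1 1) mxE eqxx.
- by rewrite (@block_mxEur _ 1 1 1 1) mxE eqxx.
- by rewrite (@block_mxEdl _ 1 1 1 1) mxE eqxx.
- by rewrite (@block_mxEdr _ 1 1 1 1) mxE eqxx.
Qed.

Definition diag_entries (ts : seq R) (i j : nat) : option R :=
  if Nat.eqb i j then Some (nth 0 ts i) else None.

Lemma represents_diag5 t1 t2 t3 t4 t5 :
  represents (diag5 t1 t2 t3 t4 t5) (diag_entries [:: t1; t2; t3; t4; t5]).
Proof.
by move=> i j; rewrite !mxE /diag_entries eqb_eq -(inj_eq val_inj) /=; case: eqP.
Qed.

End Representations.

Lemma den_gen n : gen n = den [:: (1 : C, [:: n])].
Proof. by rewrite /= scale1r addr0 mulr1. Qed.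

Lemma reify_add (a b : ext C 6) P Q : a = den P -> b = den Q -> a + b = den (P ++ Q).
Proof. by rewrite den_cat => -> ->. Qed.

Lemma reify_mul (a b : ext C 6) P Q : a = den P -> b = den Q -> a * b = den (form_mul P Q).
Proof. by rewrite den_mul => -> ->. Qed.

Lemma reify_scale (c : C) (a : ext C 6) P : a = den P -> c *: a = den (form_scale c P).
Proof. by rewrite den_scale => ->. Qed.

Lemma reify_opp (a : ext C 6) P : a = den P -> - a = den (form_scale (-1) P).
Proof. by rewrite den_scale scaleN1r => ->. Qed.

End RowCheck.

(** * The rows of the table *)

(** The proof that a form built from the e^i is the value of the list of terms
    computed from its syntax; the list is read off the type of the proof. *)
Ltac reification a :=
  lazymatch a with
  | @e ?R ?i =>
      let n := eval vm_compute in (nat_of_ord i) in constr:(@den_gen R n)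
  | ?x + ?y =>
      let p := reification x in let q := reification y in
      constr:(reify_add p q)
  | ?x * ?y =>
      let p := reification x in let q := reification y in
      constr:(reify_mul p q)
  | ?c *: ?x => let p := reification x in constr:(reify_scale c p)
  | - ?x => let p := reification x in constr:(reify_opp p)
  end.

Ltac reify_form :=
  lazymatch goal with |- ?a = _ => let p := reification a in exact p end.

Ltac representation M :=
  lazymatch M with
  | @block_mx _ ?m ?n _ _ ?B _ _ ?B' =>
      let r := representation B in
      let r' := representation B' in
      constr:(@represents_block _ m n B B' _ _ r r')
  | @jordan_block _ ?r ?t => constr:(@represents_jordan _ r t)
  | scalar_block ?t => constr:(@represents_scalar _ t)
  | rot_block ?a ?b => constr:(@represents_rot _ a b)
  | diag5 ?t1 ?t2 ?t3 ?t4 ?t5 => constr:(@represents_diag5 _ t1 t2 t3 t4 t5)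
  end.

Ltac represent :=
  lazymatch goal with |- represents ?M _ => let r := representation M in exact r end.

Lemma imaginary_sq (R : rcfType) : 'i * 'i = -1 :> R[i].
Proof. by rewrite -expr2 sqrCi. Qed.

(** The coefficients of omega and Omega are products of signs and of the
    imaginary unit, and these rules evaluate their conjugates. *)
Lemma conj_rules (R : rcfType) :
  prod (prod (forall x y : R[i], (x * y)^* = x^* * y^*)
             (forall x : R[i], (- x)^* = - x^*))
       (prod ((1 : R[i])^* = 1) (('i : R[i])^* = - 'i)).
Proof.
by split; split; try move=> x; try move=> y; rewrite ?rmorphM ?rmorphN ?rmorph1 ?conjCi.
Qed.

(** Only the coefficients survive the reduction; they are polynomials in the
    parameters and in i, and are compared modulo i * i = -1. *)
Ltac check_row :=
  lazymatch goal with |- @row_claim ?K _ ?k _ _ _ _ =>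
    lazymatch k with
    | 1%N => eapply (@row_claim1 K)
    | 2%N => eapply (@row_claim2 K)
    end;
    [ represent | reify_form .. | reflexivity | |];
    [ cbv [row_identities form_prod form_conj form_d form_mul form_exp form1
           form_scale mono_d form_d1 term_mul mono_mul insert add_term collect
           null_coefs mono_eqb row_terms block_entries jordan_entries
           scalar_entries rot_entries diag_entries nth cat size xorb negb
           Nat.eqb Nat.ltb Nat.leb Nat.sub Nat.compare addn Nat.add];
      split; repeat split; rewrite ?(conj_rules K);
      ring: (imaginary_sq K)
    | by rewrite ?mulf_eq0 ?oppr_eq0 pnatr_eq0 ?(negPf (neq0Ci _)) ]
  end.

Unset Implicit Arguments.

Theorem theorem4p4 (R : realType) :
  (* Case 4 *)
  (forall lambda mu nu : R, pattern_J3 lambda mu nu ->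
     lambda = 0 -> mu = nu ->
     let A := jordan_block 3 lambda \oplus scalar_block mu
              \oplus scalar_block nu in
     row_claim A 1 (e 4 + 'i *: e 5) (e 0 * e 1 + e 2 * e 3)
       mu%:C%C (- 4 * 'i) /\
     row_claim A 2 (('i *: e 0 + e 3) * (e 4 + 'i *: e 5)) (e 1 * e 2)
       mu%:C%C (- 4)) /\
  (* Case 5 *)
  (forall lambda mu nu : R, pattern_J2J2 lambda mu nu ->
     mu = 0 -> nu = lambda ->
     let A := jordan_block 2 lambda \oplus jordan_block 2 mu
              \oplus scalar_block nu in
     row_claim A 1 (e 2 + 'i *: e 5) (e 0 * e 1 + e 3 * e 4)
       lambda%:C%C (- 4 * 'i) /\
     row_claim A 2 ((e 0 + e 1 + 'i *: e 5) * ('i *: e 0 + e 2)) (e 3 * e 4)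
       (2 * lambda%:C%C) 4) /\
  (* Case 6a *)
  (forall lambda mu nu gamma : R, pattern_J2 lambda mu nu gamma ->
     mu = lambda -> gamma = - nu ->
     let A := jordan_block 2 lambda \oplus scalar_block mu
              \oplus scalar_block nu \oplus scalar_block gamma in
     row_claim A 1 (e 2 + 'i *: e 3) (e 0 * e 1 + e 4 * e 5)
       lambda%:C%C (- 4 * 'i) /\
     row_claim A 2 ((e 0 + e 1 + 'i *: e 3) * ('i *: e 0 + e 2)) (e 4 * e 5)
       (2 * lambda%:C%C) 4) /\
  (* Case 6b *)
  (forall lambda mu nu gamma alpha : R, pattern_J2 lambda mu nu gamma ->
     mu = alpha -> nu = alpha -> gamma = - lambda ->
     let A := jordan_block 2 lambda \oplus scalar_block mu
              \oplus scalar_block nu \oplus scalar_block gamma in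
     row_claim A 1 (e 3 + 'i *: e 4) (e 0 * e 1 + e 2 * e 5)
       alpha%:C%C (- 4 * 'i) /\
     row_claim A 2 (('i *: e 0 + e 2) * (e 3 + 'i *: e 4)) (e 1 * e 5)
       (lambda%:C%C + alpha%:C%C) 4) /\
  (* Case 6c *)
  (forall lambda mu nu gamma : R, pattern_J2 lambda mu nu gamma ->
     lambda = 0 -> mu = nu ->
     let A := jordan_block 2 lambda \oplus scalar_block mu
              \oplus scalar_block nu \oplus scalar_block gamma in
     row_claim A 1 (e 3 + 'i *: e 4) (e 0 * e 5 + e 1 * e 2)
       mu%:C%C (- 4 * 'i)) /\
  (* Case 7 *)
  (forall a b lambda : R, pattern_CJ3 a lambda -> b != 0 ->
     lambda = 0 ->
     let A := rot_block a b \oplus jordan_block 3 lambda in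
     let eta := e 1 + 'i *: e 2 in
     let tau := a%:C%C + 'i * b%:C%C in
     row_claim A 1 (e 0 + eta) (e 1 * e 2 + e 0 * e 3 + e 4 * e 5)
       tau (- 4 * 'i) /\
     row_claim A 2 (eta * (e 0 - 'i *: e 5)) (e 3 * e 4)
       tau (- 4)) /\
  (* Case 8a *)
  (forall a b lambda mu : R, pattern_CJ2 a lambda mu -> b != 0 ->
     lambda + mu = 0 ->
     let A := rot_block a b \oplus jordan_block 2 lambda
              \oplus scalar_block mu in
     let eta := e 1 + 'i *: e 2 in
     let tau := a%:C%C + 'i * b%:C%C in
     row_claim A 1 (e 0 + eta) (e 1 * e 2 + e 0 * e 3 + e 4 * e 5)
       tau (- 4 * 'i) /\
     row_claim A 2 (eta * (e 0 - 'i *: e 4)) (e 3 * e 5)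
       (tau + lambda%:C%C) 4) /\
  (* Case 8b *)
  (forall a b lambda mu : R, pattern_CJ2 a lambda mu -> b != 0 ->
     lambda = 0 ->
     let A := rot_block a b \oplus jordan_block 2 lambda
              \oplus scalar_block mu in
     let eta := e 1 + 'i *: e 2 in
     let tau := a%:C%C + 'i * b%:C%C in
     row_claim A 1 (e 0 + eta) (e 1 * e 2 + e 3 * e 4 + e 0 * e 5)
       tau (- 4 * 'i) /\
     row_claim A 2 (eta * (e 0 - 'i *: e 5)) (e 3 * e 4)
       (tau + mu%:C%C) (- 4)) /\
  (* Case 9 *)
  (forall a b lambda mu nu : R, pattern_C a lambda mu nu -> b != 0 ->
     lambda + mu = 0 ->
     let A := rot_block a b \oplus scalar_block lambda \oplus scalar_block mu
              \oplus scalar_block nu in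
     let eta := e 1 + 'i *: e 2 in
     let tau := a%:C%C + 'i * b%:C%C in
     row_claim A 1 (e 0 + eta) (e 3 * e 4 + e 0 * e 5)
       tau (- 4 * 'i) /\
     row_claim A 2 (eta * (e 0 - 'i *: e 5)) (e 3 * e 4)
       (tau + nu%:C%C) (- 4)) /\
  (* Case 10 *)
  (forall lambda mu zeta : R,
     pattern_diag [:: lambda; lambda; mu; zeta; - zeta] ->
     let A := diag5 lambda lambda mu zeta (- zeta) in
     row_claim A 1 (e 1 + 'i *: e 2) (e 0 * e 3 + e 4 * e 5)
       lambda%:C%C (- 4 * 'i) /\
     row_claim A 2 ((e 1 + 'i *: e 2) * (e 0 + 'i *: e 3)) (e 4 * e 5)
       (lambda%:C%C + mu%:C%C) 4).
Proof.
have opp (x y : R) : x + y = 0 -> y = - x.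
  by move=> /eqP; rewrite addrC addr_eq0 => /eqP.
split; first by
  move=> la mu nu _ -> -> A; rewrite /A; split; check_row.
split; first by
  move=> la mu nu _ -> -> A; rewrite /A; split; check_row.
split; first by
  move=> la mu nu ga _ -> -> A; rewrite /A; split; check_row.
split; first by
  move=> la mu nu ga al _ -> -> -> A; rewrite /A; split; check_row.
split; first by
  move=> la mu nu ga _ -> -> A; rewrite /A; check_row.
split; first by
  move=> a b la _ _ -> A eta tau; rewrite /A /eta /tau; split; check_row.
split; first by
  move=> a b la mu _ _ /opp -> A eta tau; rewrite /A /eta /tau; split; check_row.
split; first by
  move=> a b la mu _ _ -> A eta tau; rewrite /A /eta /tau; split; check_row.
split; first by
  move=> a b la mu nu _ _ /opp -> A eta tau; rewrite /A /eta /tau; split; check_row.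
move=> la mu ze _ A; rewrite /A; split; check_row.
Qed.
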